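(* Let $\Lambda$ be an artin algebra and let $\mathcal{C}$ be a functorially finite (full, additive) subcategory of $\mathrm{mod}\,\Lambda$, closed under direct summands and isomorphisms, which contains $\Lambda$ and $D\Lambda$. For each simple $\Lambda$-module $S$ let $\pi_S:P_S\to S$ be a projective cover, $\iota_S:S\to I_S$ an injective envelope, and $\theta_S:=\iota_S\pi_S:P_S\to I_S$. Then $\mathcal{C}$ is of finite representation type if and only if the depth of $\theta_S$ in $\mathcal{C}$ is finite for every simple $\Lambda$-module $S$. Moreover, in this case, if $m$ is the maximal depth of the morphisms $\theta_S$ in $\mathcal{C}$ with $S$ ranging over all simple $\Lambda$-modules, then $m+1$ is a nilpotency index of $\mathrm{rad}_{\mathcal{C}}$, i.e. $\mathrm{rad}^{m+1}_{\mathcal{C}}=0$.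
   Context: $\Lambda$ is an artin $R$-algebra over a commutative artinian ring $R$; $\mathrm{mod}\,\Lambda$ is the category of finitely generated left $\Lambda$-modules; $D=\mathrm{Hom}_R(-,J)$ with $J$ the injective envelope of $R/J_R$, $J_R$ the Jacobson radical of $R$. A left $\mathcal{C}$-approximation of $X\in\mathrm{mod}\,\Lambda$ is a morphism $\alpha:X\to C$ with $C\in\mathcal{C}$ such that every morphism $X\to C'$ with $C'\in\mathcal{C}$ factors through $\alpha$; right $\mathcal{C}$-approximations are dual. $\mathcal{C}$ is functorially finite if every $X\in\mathrm{mod}\,\Lambda$ has both a left and a right $\mathcal{C}$-approximation. $\mathcal{C}$ is of finite representation type if it has finitely many isomorphism classes of indecomposable objects. $\mathrm{rad}_{\mathcal{C}}(X,Y)=\{h\in\mathrm{Hom}_{\mathcal{C}}(X,Y) : 1_X-gh \text{ is invertible for all } g\in\mathrm{Hom}_{\mathcal{C}}(Y,X)\}$. $\mathrm{rad}^0_{\mathcal{C}}=\mathrm{Hom}_{\mathcal{C}}$, and for $i\ge 1$, $\mathrm{rad}^i_{\mathcal{C}}(X,Y)$ consists of all finite sums of compositions of $i$ morphisms in $\mathrm{rad}_{\mathcal{C}}$ through objects of $\mathcal{C}$. $\mathrm{rad}^\infty_{\mathcal{C}}=\bigcap_{i\ge1}\mathrm{rad}^i_{\mathcal{C}}$. A nilpotency index of $\mathrm{rad}_{\mathcal{C}}$ is an integer $d\ge1$ with $\mathrm{rad}^d_{\mathcal{C}}=0$. The depth in $\mathcal{C}$ of a morphism $f:X\to Y$ in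 $\mathcal{C}$ is infinite if $f\in\mathrm{rad}^\infty_{\mathcal{C}}(X,Y)$; otherwise it is the unique integer $t\ge0$ with $f\in\mathrm{rad}^t_{\mathcal{C}}(X,Y)\setminus\mathrm{rad}^{t+1}_{\mathcal{C}}(X,Y)$. *)

(* Defs.v *)
From HB Require Import structures.
From mathcomp Require Import all_boot all_order all_algebra.
From mathcomp Require Import generic_quotient ring_quotient.
From mathcomp Require Import boolp.

Set Implicit Arguments.
Unset Strict Implicit.
Unset Printing Implicit Defensive.

Import GRing.Theory.

Local Open Scope ring_scope.
Local Open Scope quotient_scope.

(* Submodules and ideals are boolean predicates; under the classical axioms of
   boolp these are all the subsets. *)
Section Modules.
Variable A : nzRingType.

Definition surj (X Y : Type) (f : X -> Y) := forall y, exists x, f x = y.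

Definition fin_gen (M : lmodType A) :=
  exists (n : nat) (v : 'I_n -> M),
    forall x : M, exists c : 'I_n -> A, x = \sum_(i < n) c i *: v i.

Definition artinian (M : lmodType A) :=
  forall N : nat -> {pred M},
    (forall i, submod_closed (N i)) ->
    (forall i, {subset N i.+1 <= N i}) ->
    exists n, forall k, (n <= k)%N -> N k =i N n.

Definition zero_module (M : lmodType A) := forall x : M, x = 0.

Definition iso (X Y : lmodType A) :=
  exists (f : {linear X -> Y}) (g : {linear Y -> X}), cancel f g /\ cancel g f.

Definition simple (S : lmodType A) :=
  ~ zero_module S /\
  forall N : {pred S}, submod_closed N ->
    (forall x, x \in N -> x = 0) \/ (forall x, x \in N).

Definition indecomposable (X : lmodType A) :=
  ~ zero_module X /\
  forall Y Z : lmodType A,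
    iso X (Y * Z)%type -> zero_module Y \/ zero_module Z.

Definition projective (P : lmodType A) :=
  forall (X Y : lmodType A) (p : {linear X -> Y}) (f : {linear P -> Y}),
    surj p -> exists g : {linear P -> X}, p \o g =1 f.

Definition injective_module (I : lmodType A) :=
  forall (X Y : lmodType A) (i : {linear X -> Y}) (f : {linear X -> I}),
    injective i -> exists g : {linear Y -> I}, g \o i =1 f.

Definition projective_cover (P X : lmodType A) (p : {linear P -> X}) :=
  [/\ projective P, surj p
    & forall (Y : lmodType A) (g : {linear Y -> P}), surj (p \o g) -> surj g].

Definition injective_envelope (X I : lmodType A) (i : {linear X -> I}) :=
  [/\ injective_module I, injective i
    & forall (Y : lmodType A) (g : {linear I -> Y}),
        injective (g \o i) -> injective g].

End Modules.

Section Residue.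
Variable R : comNzRingType.

(* idealr_closed already requires the ideal to be proper. *)
Definition maximal_ideal (m : {pred R}) :=
  idealr_closed m /\
  forall I : {pred R}, idealr_closed I -> {subset m <= I} -> I =i m.

Definition jacobson : {pred R} :=
  fun x => `[< forall m : {pred R}, maximal_ideal m -> x \in m >].

Lemma jacobson_zmod : zmod_closed jacobson.
Proof.
split=> [|x y /asboolP jx /asboolP jy]; apply/asboolP => m mm.
  by case: mm => -[].
have [m0 mB] := idealr_closedB mm.1.
by apply: mB; [apply: jx | apply: jy].
Qed.

HB.instance Definition _ := GRing.isZmodClosed.Build R jacobson jacobson_zmod.

Lemma jacobsonMl a x : x \in jacobson -> a * x \in jacobson.
Proof.
move=> /asboolP jx; apply/asboolP => m mm.
by apply: (idealr_closed_nontrivial mm.1).2; apply: jx.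
Qed.

Definition residue := Quotient.quot jacobson.

HB.instance Definition _ := GRing.Zmodule.on residue.

Definition residue_scale (a : R) (x : residue) : residue :=
  \pi_(Quotient.quot jacobson) (a * repr x).

Lemma residue_scaleE a (x : R) :
  residue_scale a (\pi_(Quotient.quot jacobson) x) =
  \pi_(Quotient.quot jacobson) (a * x).
Proof.
apply/eqP; rewrite -Quotient.idealrBE -mulrBr; apply: jacobsonMl.
by rewrite Quotient.idealrBE reprK.
Qed.

Lemma residue_scaleA a b x :
  residue_scale a (residue_scale b x) = residue_scale (a * b) x.
Proof. by rewrite [residue_scale b x]/residue_scale residue_scaleE mulrA. Qed.

Lemma residue_scale1 : left_id 1 residue_scale.
Proof.
by elim/(@quotW _ (Quotient.quot jacobson)) => x; rewrite residue_scaleE mul1r.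
Qed.

Lemma residue_scaleDr : right_distributive residue_scale +%R.
Proof.
move=> a; elim/(@quotW _ (Quotient.quot jacobson)) => x.
elim/(@quotW _ (Quotient.quot jacobson)) => y.
have piD u v : \pi_(Quotient.quot jacobson) u + \pi_(Quotient.quot jacobson) v
    = \pi_(Quotient.quot jacobson) (u + v) by rewrite raddfD.
rewrite !residue_scaleE; apply: etrans (esym (piD _ _)).
by rewrite -mulrDr -residue_scaleE; congr residue_scale; apply: piD.
Qed.

Lemma residue_scaleDl x :
  {morph residue_scale^~ x : a b / a + b}.
Proof. by move=> a b; rewrite /residue_scale mulrDl; exact: raddfD. Qed.

HB.instance Definition _ := GRing.Zmodule_isLmodule.Build R residue
  residue_scaleA residue_scale1 residue_scaleDr residue_scaleDl.

End Residue.

Definition artin_algebra (R : comNzRingType) (L : algType R) :=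
  artinian R^o /\ fin_gen (L : lmodType R).

(* D(L) = Hom_R(L, J), with (a *: f)(x) = f (x a). *)
Section Dual.
Variables (R : comNzRingType) (L : algType R) (J : lmodType R).

Definition dual : Type := {linear L -> J}.

HB.instance Definition _ := gen_eqMixin dual.
HB.instance Definition _ := gen_choiceMixin dual.

Implicit Types f g h : dual.

Lemma dualP f g : f =1 g -> f = g.
Proof.
case: f g => [f cf] [g cg] /= /funext fg; case: _ / fg in cg *.
congr GRing.Linear.Pack; case: cf cg => [a b] [a' b'].
by congr GRing.Linear.Class; [case: a a' => a [a']|case: b b' => b [b']];
   congr (_ _); apply: Prop_irrelevance.
Qed.

Definition dual_zero : dual := \0 : {linear L -> J}.
Definition dual_opp f : dual := \- f : {linear L -> J}.
Definition dual_add f g : dual := f \+ g : {linear L -> J}.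

Lemma dual_addA : associative dual_add.
Proof. by move=> f g h; apply: dualP => x /=; rewrite addrA. Qed.
Lemma dual_addC : commutative dual_add.
Proof. by move=> f g; apply: dualP => x /=; rewrite addrC. Qed.
Lemma dual_add0 : left_id dual_zero dual_add.
Proof. by move=> f; apply: dualP => x /=; rewrite add0r. Qed.
Lemma dual_addN : left_inverse dual_zero dual_opp dual_add.
Proof. by move=> f; apply: dualP => x /=; rewrite addNr. Qed.

HB.instance Definition _ := GRing.isZmodule.Build dual
  dual_addA dual_addC dual_add0 dual_addN.

Definition dual_scale_fun (a : L) f (x : L) : J := f (x * a).

Lemma dual_scale_linear a f : linear (dual_scale_fun a f).
Proof.
by move=> c x y; rewrite /dual_scale_fun mulrDl -scalerAl linearP.
Qed.

HB.instance Definition _ a f :=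
  GRing.isLinear.Build R L J *:%R (dual_scale_fun a f) (dual_scale_linear a f).

Definition dual_scale (a : L) f : dual := dual_scale_fun a f : {linear L -> J}.

Lemma dual_scaleA a b f : dual_scale a (dual_scale b f) = dual_scale (a * b) f.
Proof. by apply: dualP => x /=; rewrite /dual_scale_fun /= mulrA. Qed.
Lemma dual_scale1 : left_id 1 dual_scale.
Proof. by move=> f; apply: dualP => x /=; rewrite /dual_scale_fun mulr1. Qed.
Lemma dual_scaleDr : right_distributive dual_scale +%R.
Proof. by move=> a f g; apply: dualP. Qed.
Lemma dual_scaleDl f : {morph dual_scale^~ f : a b / a + b}.
Proof.
by move=> a b; apply: dualP => x; rewrite /= /dual_scale_fun mulrDr raddfD.
Qed.

HB.instance Definition _ := GRing.Zmodule_isLmodule.Build L dual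
  dual_scaleA dual_scale1 dual_scaleDr dual_scaleDl.

End Dual.

(* A full subcategory is given by its class of objects. *)
Section Subcategory.
Variables (A : nzRingType) (C : lmodType A -> Prop).

Definition additive_subcategory :=
  [/\ forall X, C X -> fin_gen X,
      forall X, zero_module X -> C X
    & forall X Y, C X -> C Y -> C (X * Y)%type].

Definition iso_closed := forall X Y, iso X Y -> C X -> C Y.

Definition summand_closed :=
  forall X Y Z : lmodType A, iso X (Y * Z)%type -> C X -> C Y.

Definition left_approximation (X Y : lmodType A) (a : {linear X -> Y}) :=
  C Y /\
  forall (Z : lmodType A) (f : {linear X -> Z}),
    C Z -> exists g : {linear Y -> Z}, g \o a =1 f.

Definition right_approximation (X Y : lmodType A) (a : {linear Y -> X}) :=
  C Y /\
  forall (Z : lmodType A) (f : {linear Z -> X}),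
    C Z -> exists g : {linear Z -> Y}, a \o g =1 f.

Definition functorially_finite :=
  forall X : lmodType A, fin_gen X ->
    (exists (Y : lmodType A) (a : {linear X -> Y}), left_approximation a) /\
    (exists (Y : lmodType A) (a : {linear Y -> X}), right_approximation a).

Definition finite_rep_type :=
  exists (n : nat) (M : 'I_n -> lmodType A),
    (forall i, C (M i) /\ indecomposable (M i)) /\
    forall X, C X -> indecomposable X -> exists i, iso X (M i).

Definition rad (X Y : lmodType A) (h : {linear X -> Y}) :=
  forall g : {linear Y -> X},
    exists u : {linear X -> X},
      cancel (fun x => x - g (h x)) u /\ cancel u (fun x => x - g (h x)).

(* rad_comp i h, for i >= 1: h is a composition of i morphisms of rad with all
   intermediate objects in C. *)
Inductive rad_comp : nat -> forall X Y : lmodType A, {linear X -> Y} -> Prop :=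
| rad_comp1 (X Y : lmodType A) (h : {linear X -> Y}) : rad h -> rad_comp 1 h
| rad_compS i (X Y Z : lmodType A) (g : {linear Y -> Z}) (f : {linear X -> Y})
    (h : {linear X -> Z}) :
    C Y -> rad_comp i g -> rad f -> h =1 g \o f -> rad_comp i.+1 h.

Definition rad_pow (i : nat) (X Y : lmodType A) (h : {linear X -> Y}) :=
  if i is 0 then True else
  exists (n : nat) (s : 'I_n -> {linear X -> Y}),
    (forall k, rad_comp i (s k)) /\ forall x, h x = \sum_(k < n) s k x.

Definition rad_infty (X Y : lmodType A) (h : {linear X -> Y}) :=
  forall i, (1 <= i)%N -> rad_pow i h.

Definition finite_depth (X Y : lmodType A) (h : {linear X -> Y}) :=
  ~ rad_infty h.

Definition has_depth (X Y : lmodType A) (h : {linear X -> Y}) (t : nat) :=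
  rad_pow t h /\ ~ rad_pow t.+1 h.

Definition nilpotency_index (d : nat) :=
  (1 <= d)%N /\
  forall (X Y : lmodType A) (h : {linear X -> Y}),
    C X -> C Y -> rad_pow d h -> h =1 \0.

End Subcategory.

(* Main.v *)
From HB Require Import structures.
From mathcomp Require Import all_boot all_order all_algebra.
From mathcomp Require Import generic_quotient ring_quotient.
From mathcomp Require Import boolp classical_sets.
Require Import Defs.

Set Implicit Arguments.
Unset Strict Implicit.
Unset Printing Implicit Defensive.

Import GRing.Theory.
Local Open Scope ring_scope.

(* A nonzero f : X -> Y in rad^d has a simple submodule S in its image. Lifting
   P_S -> S through X and extending S -> I_S along S -> Y gives theta_S = v f u,
   so theta_S is in rad^d. As there are finitely many simple modules, finite
   depths of the theta_S make rad_C nilpotent, and m + 1 is a nilpotency index.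

   If rad_C is nilpotent, then C is of finite type: every indecomposable X in C
   has a right almost split map Z -> X in C, and following these maps backwards
   from D(L) reaches, up to finitely many X, only maps X -> D(L) of arbitrarily
   large depth, while D(L) is a cogenerator. The almost split map is obtained
   without transpose. A presentation L^a -> L^b -> X -> 0 and a functional on
   End(X) vanishing on rad End(X) but not at 1 give maps
   X -> D(L)^b <- D(L)^a, and a map W -> X is radical iff it factors through
   their pullback; take a right C-approximation of the pullback.

   Conversely, if C is of finite type, let M be the sum of its indecomposables
   and J = rad End(M). The chain J^k M stops, so J^k M = 0 by Nakayama, and every
   composition of radical maps in C is a sum of compositions through M. Hence
   rad_C is nilpotent, and theta_S, being nonzero, has finite depth. *)

(** * Submodules as Prop-valued predicates *)

Section Linear.
Variable A : nzRingType.
Implicit Types X Y Z : lmodType A.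

(** The structure on a linear map consists of proofs, so extensionality and proof irrelevance leave
    only the underlying functions to compare. *)
Lemma linear_eq X Y (f g : {linear X -> Y}) : f =1 g -> f = g.
Proof.
case: f g => [f cf] [g cg] /= /funext fg; case: _ / fg in cg *.
congr GRing.Linear.Pack; case: cf cg => [a b] [a' b'].
by congr GRing.Linear.Class; [case: a a' => a [a']|case: b b' => b [b']];
   congr (_ _); apply: Prop_irrelevance.
Qed.

Lemma linear_fun X Y (f : X -> Y) :
  linear f -> exists g : {linear X -> Y}, g =1 f.
Proof.
move=> lf.
pose F := HB.pack_for {linear X -> Y} f (GRing.isLinear.Build A X Y *:%R f lf).
by exists F.
Qed.

Lemma bij_iso X Y (f : {linear X -> Y}) :
  bijective f -> exists g : {linear Y -> X}, cancel f g /\ cancel g f.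
Proof.
case=> g fK gK; have [h hg] : exists h : {linear Y -> X}, h =1 g.
  apply: linear_fun => a x y; apply: (can_inj fK).
  by rewrite gK linearP !gK.
by exists h; split=> x; rewrite hg.
Qed.

Lemma inj_surj_bij (X Y : Type) (f : X -> Y) :
  injective f -> surj f -> bijective f.
Proof.
move=> fI /choice[g gP]; exists g => // x; apply: fI; exact: gP.
Qed.

Lemma linear_inj X Y (f : {linear X -> Y}) :
  (forall x, f x = 0 -> x = 0) -> injective f.
Proof.
move=> f0 x y fxy; apply/eqP; rewrite -subr_eq0; apply/eqP/f0.
by rewrite linearB fxy subrr.
Qed.

End Linear.

Section Submodules.
Variables (A : nzRingType) (M : lmodType A).

(** Prop-valued, so that images, sums and spans can be written with quantifiers; [artinian_min] and
    [simpleP] translate to boolean predicates. *)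
Record is_sub (N : M -> Prop) : Prop := IsSub {
  sub0 : N 0;
  subD : forall x y, N x -> N y -> N (x + y);
  subZ : forall a x, N x -> N (a *: x) }.

Lemma subN N x : is_sub N -> N x -> N (- x).
Proof. by move=> sN Nx; rewrite -scaleN1r; apply: subZ. Qed.

Lemma subB N x y : is_sub N -> N x -> N y -> N (x - y).
Proof. by move=> sN Nx Ny; apply: subD => //; apply: subN. Qed.

Lemma sub_sum N (T : Type) (s : seq T) (F : T -> M) :
  is_sub N -> (forall i, N (F i)) -> N (\sum_(i <- s) F i).
Proof.
by move=> sN NF; elim/big_ind: _ => //; [apply: sub0|apply: subD].
Qed.

Lemma sub_all : is_sub (fun=> True). Proof. by []. Qed.

Lemma sub_zero : is_sub (fun x => x = 0).
Proof.
by split=> // [x y -> ->|a x ->]; rewrite ?addr0 ?scaler0.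
Qed.

Lemma sub_cap N K : is_sub N -> is_sub K -> is_sub (fun x => N x /\ K x).
Proof.
move=> sN sK; split; first by split; apply: sub0.
  by move=> x y [? ?] [? ?]; split; apply: subD.
by move=> a x [? ?]; split; apply: subZ.
Qed.

Definition subs_add (N K : M -> Prop) x := exists y z, [/\ N y, K z & x = y + z].

Lemma sub_add N K : is_sub N -> is_sub K -> is_sub (subs_add N K).
Proof.
move=> sN sK; split.
- by exists 0, 0; rewrite addr0; split=> //; apply: sub0.
- move=> _ _ [a [b [Na Kb ->]]] [c [d [Nc Kd ->]]].
  by exists (a + c), (b + d); rewrite addrACA; split=> //; apply: subD.
- move=> t _ [a [b [Na Kb ->]]]; exists (t *: a), (t *: b).
  by rewrite scalerDr; split=> //; apply: subZ.
Qed.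

Definition cyc (x y : M) := exists a : A, y = a *: x.

Lemma sub_cyc x : is_sub (cyc x).
Proof.
split; first by exists 0; rewrite scale0r.
  by move=> _ _ [a ->] [b ->]; exists (a + b); rewrite scalerDl.
by move=> a _ [b ->]; exists (a * b); rewrite scalerA.
Qed.

Lemma cyc_id x : cyc x x. Proof. by exists 1; rewrite scale1r. Qed.

(** Impredicative form, as an intersection of submodules; [spanE] recovers coefficients. *)
Definition span (s : seq M) y :=
  forall N, is_sub N -> (forall x, x \in s -> N x) -> N y.

Lemma sub_span s : is_sub (span s).
Proof.
split=> [N sN _|x y sx sy N sN Ns|a x sx N sN Ns]; first exact: sub0.
  by apply: subD => //; [apply: sx|apply: sy].
by apply: subZ => //; apply: sx.
Qed.

Lemma span_mem s x : x \in s -> span s x.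
Proof. by move=> xs N sN; apply. Qed.

Lemma span_sub s N y :
  is_sub N -> (forall x, x \in s -> N x) -> span s y -> N y.
Proof. by move=> sN Ns; apply. Qed.

Lemma spanE s x : span s x ->
  exists c : 'I_(size s) -> A, x = \sum_(i < size s) c i *: s`_i.
Proof.
apply: (@span_sub s (fun y => exists c : 'I_(size s) -> A, y = \sum_i c i *: s`_i));
  first split.
- by exists (fun=> 0); rewrite big1 // => i _; rewrite scale0r.
- move=> _ _ [c ->] [d ->]; exists (fun i => c i + d i); rewrite -big_split.
  by apply: eq_bigr => i _; rewrite scalerDl.
- move=> a _ [c ->]; exists (fun i => a * c i); rewrite scaler_sumr.
  by apply: eq_bigr => i _; rewrite scalerA.
move=> y ys; have iy : (index y s < size s)%N by rewrite index_mem.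
exists (fun i : 'I_(size s) => (i == Ordinal iy)%:R).
rewrite (bigD1 (Ordinal iy)) //= eqxx scale1r nth_index // big1 ?addr0 // => i.
by move=> /negbTE ->; rewrite scale0r.
Qed.

Lemma fin_gen_span : fin_gen M <-> exists s, forall x, span s x.
Proof.
split=> [[n [v vP]]|[s sP]].
  exists (codom v) => x; have [c ->] := vP x => N sN Ns; apply: sub_sum => // i.
  by apply: subZ => //; apply: Ns; apply: codom_f.
by exists (size s), (fun i => s`_i) => x; apply: spanE.
Qed.

Section Smod.
Variables (N : M -> Prop) (sN : is_sub N).

(** The closure proof is an argument of the type, so that the module instances below can be attached
    to it. *)
Definition smod (_ : is_sub N) : Type := {x : M | N x}.
Local Notation S := (smod sN).

HB.instance Definition _ := gen_eqMixin S.
HB.instance Definition _ := gen_choiceMixin S.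

Definition sval_ (x : S) : M := sval x.

Lemma sval_inj : injective sval_.
Proof. by move=> [x Nx] [y Ny] /= xy; apply: eq_exist. Qed.

Lemma svalP (x : S) : N (sval_ x). Proof. exact: (proj2_sig x). Qed.

Definition smk x (Nx : N x) : S := exist _ x Nx.

Definition smod0 : S := smk (sub0 sN).
Definition smodD (x y : S) : S := smk (subD sN (svalP x) (svalP y)).
Definition smodN (x : S) : S := smk (subN sN (svalP x)).
Definition smodZ a (x : S) : S := smk (subZ sN a (svalP x)).

Fact smod_addA : associative smodD.
Proof. by move=> x y z; apply: sval_inj; rewrite /= addrA. Qed.
Fact smod_addC : commutative smodD.
Proof. by move=> x y; apply: sval_inj; rewrite /= addrC. Qed.
Fact smod_add0 : left_id smod0 smodD.
Proof. by move=> x; apply: sval_inj; rewrite /= add0r. Qed.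
Fact smod_addN : left_inverse smod0 smodN smodD.
Proof. by move=> x; apply: sval_inj; rewrite /= addNr. Qed.

HB.instance Definition _ := GRing.isZmodule.Build S
  smod_addA smod_addC smod_add0 smod_addN.

Fact smod_scaleA a b x : smodZ a (smodZ b x) = smodZ (a * b) x.
Proof. by apply: sval_inj; rewrite /= scalerA. Qed.
Fact smod_scale1 : left_id 1 smodZ.
Proof. by move=> x; apply: sval_inj; rewrite /= scale1r. Qed.
Fact smod_scaleDr : right_distributive smodZ +%R.
Proof. by move=> a x y; apply: sval_inj; rewrite /= scalerDr. Qed.
Fact smod_scaleDl x : {morph smodZ^~ x : a b / a + b}.
Proof. by move=> a b; apply: sval_inj; rewrite /= scalerDl. Qed.

HB.instance Definition _ := GRing.Zmodule_isLmodule.Build A S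
  smod_scaleA smod_scale1 smod_scaleDr smod_scaleDl.

Fact sval_linear : linear sval_. Proof. by []. Qed.
HB.instance Definition _ := GRing.isLinear.Build A S M *:%R sval_ sval_linear.

Lemma lift_smod (X : lmodType A) (f : {linear X -> M}) :
  (forall x, N (f x)) -> exists g : {linear X -> S}, forall x, sval_ (g x) = f x.
Proof.
move=> Nf; have [g gP] : exists g : {linear X -> S}, g =1 fun x => smk (Nf x).
  by apply: linear_fun => a x y; apply: sval_inj; rewrite /= linearP.
by exists g => x; rewrite gP.
Qed.

End Smod.
End Submodules.
Arguments subs_add {A M}.

Section Images.
Variables (A : nzRingType) (X Y : lmodType A) (f : {linear X -> Y}).

Definition im (B : X -> Prop) y := exists2 x, B x & y = f x.

Lemma sub_im B : is_sub B -> is_sub (im B).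
Proof.
move=> sB; split; first by exists 0; rewrite ?linear0 //; apply: sub0.
  move=> _ _ [x Bx ->] [y By ->]; exists (x + y); first exact: subD.
  by rewrite linearD.
by move=> a _ [x Bx ->]; exists (a *: x); [apply: subZ|rewrite linearZ].
Qed.

Lemma sub_preim (N : Y -> Prop) : is_sub N -> is_sub (fun x => N (f x)).
Proof.
move=> sN; split; first by rewrite linear0; apply: sub0.
  by move=> x y Nx Ny; rewrite linearD; apply: subD.
by move=> a x Nx; rewrite linearZ; apply: subZ.
Qed.

Lemma sub_ker : is_sub (fun x => f x = 0).
Proof. exact: sub_preim (sub_zero _). Qed.

End Images.

(** * Modules of finite length *)

Section Length.
Variable A : nzRingType.
Implicit Types X Y M : lmodType A.

(* The length of the submodule B is at most n. *)
Fixpoint lenle M n (B : M -> Prop) : Prop :=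
  if n is n'.+1 then
    forall C, is_sub C -> (forall x, C x -> B x) -> (exists2 x, B x & ~ C x) ->
      lenle n' C
  else forall x, B x -> x = 0.

Definition flen M (B : M -> Prop) := exists n, lenle n B.

Lemma lenle_sub M n (B C : M -> Prop) :
  is_sub C -> (forall x, C x -> B x) -> lenle n B -> lenle n C.
Proof.
case: n => [|n] sC CB Bn; first by move=> x /CB /Bn.
move=> D sD DC [x Cx nDx]; apply: Bn => //; first by move=> y /DC/CB.
by exists x => //; apply: CB.
Qed.

Lemma flen_sub M (B C : M -> Prop) :
  is_sub C -> (forall x, C x -> B x) -> flen B -> flen C.
Proof. by move=> sC CB [n Bn]; exists n; apply: lenle_sub Bn. Qed.

(** Induction on [m + n]: a proper submodule [C] of [B] has a smaller image or a smaller kernel. If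
    both agreed, each [x] in [B] would differ from an element of [C] by a kernel element, itself in
    [C]. *)
Lemma lenle_additive X Y (f : {linear X -> Y}) m n (B : X -> Prop) :
  is_sub B -> lenle m (im f B) -> lenle n (fun x => B x /\ f x = 0) ->
  lenle (m + n) B.
Proof.
move Dk: (m + n)%N => k; elim: k m n Dk B => [|k IH] m n Dk B sB Bm Bn.
  case: m n Dk Bm Bn => // -[] //= _ Bm Bn x Bx; apply: Bn; split=> //.
  by apply: Bm; exists x.
move=> C sC CB [x Bx nCx].
have sCk : is_sub (fun x => C x /\ f x = 0) := sub_cap sC (sub_ker f).
have [[y By nCy]|imC] := pselect (exists2 y, im f B y & ~ im f C y).
  case: m Dk Bm => [_ Bm|m [Dk] Bm].
    by case: nCy; rewrite (Bm y By); apply: sub0 (sub_im f sC).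
  apply: (IH _ _ Dk _ sC); last by apply: lenle_sub Bn => // z [/CB].
  apply: Bm; [exact: sub_im|by move=> _ [z Cz ->]; exists z; first exact: CB|].
  by exists y.
have [[y [By fy] nCy]|kerC] := pselect (exists2 y, B y /\ f y = 0 & ~ (C y /\ f y = 0)).
  case: n Dk Bn => [_ Bn|n]; last first.
    rewrite addnS => -[Dk] Bn; apply: (IH _ _ Dk _ sC); last first.
      by apply: Bn => //; [move=> z [/CB]|exists y].
    apply: lenle_sub Bm; first exact: sub_im.
    by move=> _ [z Cz ->]; exists z; first exact: CB.
  by case: nCy; rewrite (Bn y (conj By fy)); apply: sub0 sCk.
case: nCx; have [c Cc fxc] : im f C (f x).
  by apply: contrapT => nC; apply: imC; exists (f x) => //; exists x.
have [Cxc _] : C (x - c) /\ f (x - c) = 0.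
  apply: contrapT => nC; apply: kerC; exists (x - c) => //.
  by split; [apply: subB (CB _ _) => //|rewrite linearB fxc subrr].
by rewrite -(subrK c x); apply: subD.
Qed.

(** A proper submodule of the image is the image of its preimage in [B], which is proper in [B]. *)
Lemma lenle_im X Y (f : {linear X -> Y}) n (B : X -> Prop) :
  is_sub B -> lenle n B -> lenle n (im f B).
Proof.
elim: n B => [|n IH] B sB Bn; first by move=> _ [x /Bn -> ->]; rewrite linear0.
move=> C sC CB [_ [x Bx ->] nCx].
have sC' := sub_cap sB (sub_preim f sC).
apply: (@lenle_sub _ _ (im f (fun x => B x /\ C (f x)))) => //.
  by move=> y Cy; have [z Bz yz] := CB y Cy; exists z; rewrite -?yz.
by apply: IH => //; apply: Bn => //; [move=> ? []|exists x => // -[]].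
Qed.

Lemma flen_im X Y (f : {linear X -> Y}) (B : X -> Prop) :
  is_sub B -> flen B -> flen (im f B).
Proof. by move=> sB [n Bn]; exists n; apply: lenle_im. Qed.

Lemma flen_additive X Y (f : {linear X -> Y}) (B : X -> Prop) :
  is_sub B -> flen (im f B) -> flen (fun x => B x /\ f x = 0) -> flen B.
Proof.
by move=> sB [m Bm] [n Bn]; exists (m + n)%N; apply: lenle_additive Bm Bn.
Qed.

Lemma lenle_inj X Y (f : {linear X -> Y}) n (B : X -> Prop) :
  is_sub B -> injective f -> lenle n (im f B) -> lenle n B.
Proof.
move=> sB fI Bn; rewrite -[n]addn0; apply: lenle_additive Bn _ => // x [_ fx].
by apply: fI; rewrite fx linear0.
Qed.

(** The sum is the image of the product [NK] under addition, and [NK] has finite length by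
    additivity along the first projection. *)
Lemma flen_add M (N K : M -> Prop) :
  is_sub N -> is_sub K -> flen N -> flen K -> flen (subs_add N K).
Proof.
move=> sN sK fN fK.
have [inr_ inrE] : exists h : {linear M -> (M * M)%type}, h =1 fun x => (0, x).
  by apply: linear_fun => a x y; congr pair; rewrite /= scaler0 addr0.
have [add addE] : exists h : {linear (M * M)%type -> M}, h =1 fun x => x.1 + x.2.
  by apply: linear_fun => a x y /=; rewrite scalerDr addrACA.
have [p pE] : exists h : {linear (M * M)%type -> M}, h =1 fst by apply: linear_fun.
pose NK (x : (M * M)%type) := N x.1 /\ K x.2.
have sNK : is_sub NK.
  split; first by split; apply: sub0.
    by move=> x y [? ?] [? ?]; split; apply: subD.
  by move=> a x [? ?]; split; apply: subZ.
apply: (@flen_sub _ (im add NK)); first exact: sub_add.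
  by move=> _ [y [z [Ny Kz ->]]]; exists (y, z); rewrite ?addE.
apply: flen_im => //. apply: (flen_additive (f := p)) => //.
  by apply: flen_sub fN; [exact: sub_im|move=> _ [x [Nx _] ->]; rewrite pE].
apply: flen_sub (flen_im inr_ sK fK).
  exact: sub_cap sNK (sub_ker p).
move=> [x y] [[/= _ Ky]]; rewrite pE /= => ->.
by exists y => //; rewrite inrE.
Qed.

Lemma flen_cyc M (x : M) : flen (fun _ : A^o => True) -> flen (cyc x).
Proof.
move=> fA; have [f fE] : exists f : {linear A^o -> M}, f =1 fun a => (a : A) *: x.
  by apply: linear_fun => a b c; rewrite scalerDl scalerA.
apply: flen_sub (flen_im f (sub_all _) fA); first exact: sub_cyc.
by move=> _ [a ->]; exists a; rewrite ?fE.
Qed.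

Lemma fin_gen_flen M :
  flen (fun _ : A^o => True) -> fin_gen M -> flen (fun _ : M => True).
Proof.
move=> fA /fin_gen_span[s sM].
suff fs : flen (span s) by apply: flen_sub fs => // x _; apply: sM.
elim: s {sM} => [|x s IH].
  by exists 0%N => x; apply: (@span_sub _ _ _ (fun y => y = 0)) => //; apply: sub_zero.
apply: flen_sub (flen_add (sub_cyc x) (sub_span s) (flen_cyc x fA) IH).
  exact: sub_span.
move=> y; apply: span_sub; first by apply: sub_add; [exact: sub_cyc|exact: sub_span].
move=> z; rewrite inE => /predU1P[->|zs].
  by exists x, 0; rewrite addr0; split=> //; [exact: cyc_id|exact: sub0 (sub_span s)].
exists 0, z; rewrite add0r; split=> //; last exact: span_mem.
exact: sub0 (sub_cyc x).
Qed.

(** If no finite set spanned [N], adjoining elements outside the current span would produce spans of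
    length above every [k]. *)
Lemma flen_span M (N : M -> Prop) : is_sub N -> flen N ->
  exists s, (forall x, x \in s -> N x) /\ forall x, N x -> span s x.
Proof.
move=> sN [n Nn]; apply: contrapT => nfg.
have H k : exists s, (forall x, x \in s -> N x) /\ ~ lenle k (span s).
  elim: k => [|k [s [sN' nk]]].
    have [x Nx nx] : exists2 x, N x & x <> 0.
      apply: contrapT => nN; apply: nfg; exists [::]; split=> // x Nx.
      suff -> : x = 0 by apply: sub0 (sub_span _).
      by apply: contrapT => nx; apply: nN; exists x.
    exists [:: x]; split=> [y|len0]; first by rewrite inE => /eqP ->.
    by apply: nx; apply: len0; apply: span_mem; rewrite inE.
  have [x Nx nx] : exists2 x, N x & ~ span s x.
    apply: contrapT => nN; apply: nfg; exists s; split=> // x Nx.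
    by apply: contrapT => nx; apply: nN; exists x.
  exists (x :: s); split=> [y|lenS].
    by rewrite inE => /predU1P[->|/sN'].
  apply: nk; apply: lenS; first exact: sub_span.
    move=> y ys K sK Ks; apply: ys => // z zs; apply: Ks.
    by rewrite inE zs orbT.
  by exists x => //; apply: span_mem; rewrite inE eqxx.
have [s [sN' []]] := H n; apply: lenle_sub Nn; first exact: sub_span.
by move=> x; apply: (span_sub sN).
Qed.

Lemma lenle_desc M n (N : nat -> M -> Prop) :
  (forall i, is_sub (N i)) -> (forall i x, N i.+1 x -> N i x) ->
  lenle n (N 0%N) -> exists k, forall x, N k x -> N k.+1 x.
Proof.
elim: n N => [|n IH] N sN dN Nn.
  by exists 0%N => x /Nn ->; apply: sub0.
have [[x N0x nx]|H] := pselect (exists2 x, N 0%N x & ~ N 1%N x).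
  have [k kP] := IH (fun i => N i.+1) (fun i => sN i.+1) (fun i => @dN i.+1)
    (Nn _ (sN 1%N) (@dN 0%N) (ex_intro2 _ _ x N0x nx)).
  by exists k.+1.
by exists 0%N => x N0x; apply: contrapT => nx; apply: H; exists x.
Qed.

(** If every step were strict, the member of index [k + 1] would have length above [k], for all
    [k]. *)
Lemma lenle_asc M n (N : nat -> M -> Prop) :
  (forall i, is_sub (N i)) -> (forall i x, N i x -> N i.+1 x) ->
  lenle n (fun _ : M => True) -> exists k, forall x, N k.+1 x -> N k x.
Proof.
move=> sN iN Mn; apply: contrapT => nk.
have strict k : exists2 x, N k.+1 x & ~ N k x.
  apply: contrapT => H; apply: nk; exists k => x Nx.
  by apply: contrapT => nx; apply: H; exists x.
have H k : ~ lenle k (N k.+1).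
  elim: k => [|k IH] len.
    by have [x /len -> []] := strict 0%N; apply: sub0 (sN _).
  by apply: IH; apply: len; [exact: sN|exact: iN|exact: strict].
by apply: (H n); apply: lenle_sub Mn.
Qed.

Lemma simple_sub M (B : M -> Prop) : is_sub B -> flen B ->
  (exists2 x, B x & x <> 0) ->
  exists S : M -> Prop, [/\ is_sub S, forall x, S x -> B x,
    exists2 x, S x & x <> 0
  & forall N, is_sub N -> (forall x, N x -> S x) ->
      (exists2 x, N x & x <> 0) -> forall x, S x -> N x].
Proof.
move=> sB [n Bn]; elim: n B sB Bn => [|n IH] B sB Bn [x Bx nx].
  by case: nx; apply: Bn.
have [[C [sC CB nC C0]]|nC] := pselect (exists C : M -> Prop,
  [/\ is_sub C, forall x, C x -> B x, exists2 x, B x & ~ C x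
     & exists2 x, C x & x <> 0]).
  have [S [sS SC S0 Smin]] := IH C sC (Bn C sC CB nC) C0.
  by exists S; split=> // y /SC/CB.
exists B; split=> //; first by exists x.
move=> N sN NB N0 y By; apply: contrapT => nNy; apply: nC.
by exists N; split=> //; exists y.
Qed.

(** Without a minimal member, repeated choice of a smaller one would give an infinite strictly
    descending chain. *)
Lemma artinian_min M (P : (M -> Prop) -> Prop) : artinian M ->
  (exists2 N, is_sub N & P N) ->
  exists N, [/\ is_sub N, P N &
    forall K, is_sub K -> P K -> (forall x, K x -> N x) -> forall x, N x -> K x].
Proof.
move=> aM [N0 sN0 PN0]; apply: contrapT => nmin.
pose T := {N : M -> Prop | is_sub N /\ P N}.
have next (N : T) : exists K : T, (forall x, sval K x -> sval N x) /\
    exists2 x, sval N x & ~ sval K x.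
  case: N => N [sN PN] /=; apply: contrapT => nK; apply: nmin.
  exists N; split=> // K sK PK KN x Nx; apply: contrapT => nKx; apply: nK.
  by exists (exist _ K (conj sK PK)); split=> //; exists x.
have [f fP] := choice next.
pose s i : T := iter i f (exist _ N0 (conj sN0 PN0)).
have [||n nP] := aM (fun i => [pred x | `[< sval (s i) x >]]).
- move=> i; have [sN _] := proj2_sig (s i); split=> [|a x y].
    by apply/asboolP; apply: sub0 sN.
  move=> /asboolP Nx /asboolP Ny; apply/asboolP.
  by apply: (subD sN) => //; apply: (subZ sN).
- by move=> i x /asboolP /((fP _).1 x) sx; apply/asboolP.
have [x Nx []] := (fP (s n)).2.
have := nP n.+1 (leqnSn n) x; rewrite !inE => e.
by apply/asboolP; rewrite -[f (s n)]/(s n.+1) e; apply/asboolP.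
Qed.

Lemma maximal_avoiding M (K : M -> Prop) x : is_sub K -> ~ K x ->
  exists N, [/\ is_sub N, forall y, K y -> N y, ~ N x &
    forall N', is_sub N' -> (forall y, N y -> N' y) -> ~ N' x ->
      forall y, N' y -> N y].
Proof.
move=> sK nKx.
pose good (N : set M) := [/\ is_sub N, forall y, K y -> N y & ~ N x].
pose P (N : set M) := N = set0 \/ good N.
have [|N [PN Nmax]] := @Zorn_bigcup M P.
- move=> F FP tot.
  have [[N0 FN0 gN0]|nF] := pselect (exists2 N0, F N0 & good N0); last first.
    left; rewrite bigcup0 // => N FN; case: (FP _ FN) => // gN.
    by case: nF; exists N.
  have gF N y : F N -> N y -> good N.
    by move=> FN Ny; case: (FP _ FN) => // N0e; move: Ny; rewrite N0e.
  right; split.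
  + split; first by exists N0 => //; apply: sub0; case: gN0.
      move=> y z [N1 F1 N1y] [N2 F2 N2z].
      have [s1 _ _] := gF _ _ F1 N1y; have [s2 _ _] := gF _ _ F2 N2z.
      by case: (tot _ _ F1 F2) => le; [exists N2|exists N1] => //;
        apply: subD => //; apply: le.
    move=> a y [N1 F1 N1y]; exists N1 => //; apply: subZ => //.
    by case: (gF _ _ F1 N1y).
  + by move=> y Ky; exists N0 => //; case: gN0 => _ + _; apply.
  + by move=> [N1 F1 N1x]; case: (gF _ _ F1 N1x).
have gN : good N.
  case: PN => // N0; case: (Nmax K); last by right.
  by rewrite N0; split=> [y //|/(_ 0 (sub0 sK))].
case: gN => sN KN nNx; exists N; split=> // N' sN' NN' nN'x y N'y.
apply: contrapT => nNy; apply: (Nmax N'); last first.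
  by right; split=> // z /KN/NN'.
by split=> // /(_ y N'y).
Qed.

End Length.

(* Hopkins: a minimal ideal I of infinite length would be a vector space over
   the residue field at its annihilator, all of whose proper subspaces have
   finite length. *)
Lemma artinian_flen (R : comNzRingType) :
  artinian R^o -> flen (fun _ : R^o => True).
Proof.
move=> aR; apply: contrapT => nfR.
have [|I [sI nfI Imin]] := @artinian_min R R^o (fun N => ~ flen N) aR.
  by exists (fun=> True).
have fprop K x : is_sub K -> (forall x, K x -> I x) -> I x -> ~ K x -> flen K.
  move=> sK KI Ix nKx; apply: contrapT => nfK; apply: nKx.
  exact: Imin Ix.
have mulE (a : R) : exists f : {linear R^o -> R^o}, f =1 fun x => a * x.
  by apply: linear_fun => b x y; rewrite mulrDr mulrCA.
(* Otherwise [a I] misses [x] and the kernel of [a] on [I] misses [y]; both then have finite length,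
   and so has [I]. *)
have mul_surj (a y : R) : I y -> a * y <> 0 ->
    forall x, I x -> exists2 z, I z & x = a * z.
  move=> Iy ay0 x Ix; have [f fE] := mulE a.
  apply: contrapT => nx; apply: nfI; apply: (flen_additive (f := f)) => //.
    apply: (fprop _ x) => //; [exact: sub_im| |].
      by move=> _ [z Iz ->]; rewrite fE; apply: (subZ sI).
    by move=> [z Iz xz]; apply: nx; exists z; rewrite // xz fE.
  apply: (fprop _ y) => //; [exact: sub_cap sI (sub_ker f)|by move=> ? []|].
  by rewrite fE => -[_ /ay0].
(* A minimal ideal containing a power of [a] gives [a ^+ n = r * a ^+ n.+1]. Since [a I = I], every
   element of [I] is a multiple of [a ^+ n], so [r] inverts [a] on [I]. *)
have mul_inv (a y : R) : I y -> a * y <> 0 ->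
    exists r, forall x, I x -> r * (a * x) = x.
  move=> Iy ay0.
  have [|K [sK [n Kn] Kmin]] :=
      @artinian_min R R^o (fun N => exists n, N (a ^+ n)) aR.
    by exists (fun=> True) => //; exists 0%N.
  have [||r rE] := Kmin (@cyc R R^o (a ^+ n.+1)) (sub_cyc _) _ _ _ Kn.
  - by exists n.+1; apply: cyc_id.
  - move=> _ [r ->]; apply: (subZ sK).
    by rewrite exprS; apply: (subZ sK a).
  exists r => x Ix; have [z Iz ->] : exists2 z, I z & x = a ^+ n * z.
    elim: n {Kn rE} => [|n [z Iz ->]]; first by exists x; rewrite ?mul1r.
    have [w Iw ->] := mul_surj a y Iy ay0 z Iz.
    by exists w; rewrite // exprSr mulrA.
  rewrite {2}rE; change (r * (a * (a ^+ n * z)) = r * a ^+ n.+1 * z).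
  by rewrite exprS !mulrA.
have [x Ix nx] : exists2 x, I x & x <> 0.
  apply: contrapT => nI; apply: nfI; exists 0%N => x Ix.
  by apply: contrapT => nx; apply: nI; exists x.
(* [R x] has length at most 1: any nonzero multiple of [x] can be multiplied back to [x]. *)
have fx : flen (@cyc R R^o x).
  exists 1%N => C sC CX [z [b ->] nCz] y Cy; apply: contrapT => ny.
  have [a ya] := CX y Cy; have ay0 : a * x <> 0 by rewrite -[a * x]/(a *: (x : R^o)) -ya.
  have [r rE] := mul_inv a x Ix ay0; apply: nCz; apply: (subZ sC).
  by rewrite -(rE x Ix); apply: (subZ sC r); rewrite -[a * x]/(a *: (x : R^o)) -ya.
(* [N] serves as a hyperplane. For [y] in [I] outside [N], maximality gives [x = n + a y], and
   inverting [a] puts [y] in [N + R x]; so [I] is the sum of [N] cut with [I] and [R x], both of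
   finite length. *)
have [N [sN _ nNx Nmax]] := maximal_avoiding (sub_zero R^o) nx.
have sNI := sub_cap sN sI.
apply: nfI; apply: flen_sub (flen_add sNI (sub_cyc x) _ fx) => //; last first.
  by apply: (fprop _ x) => // [y []|[]].
move=> y Iy; have [Ny|nNy] := pselect (N y).
  exists y, 0; split=> //; first exact: (sub0 (sub_cyc _)).
  by rewrite addr0.
have [n [_ [Nn [a ->] xE]]] : subs_add N (cyc y) x.
  apply: contrapT => nx'; apply: nNy; apply: (Nmax _ (sub_add sN (sub_cyc y))) => //.
    by move=> z Nz; exists z, 0; split=> //; rewrite ?addr0 //; apply: (sub0 (sub_cyc y)).
  by exists 0, y; split=> //; rewrite ?add0r //; [apply: sub0|apply: cyc_id].
have ay0 : a * y <> 0.
  by move=> ay; apply: nNx; rewrite xE [a *: y]ay addr0.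
have [r rE] := mul_inv a y Iy ay0.
exists (- (r *: n)), (r *: x); split; last 1 first.
- by rewrite xE scalerDr addKr [RHS](rE y Iy).
- have In : I n.
    by have -> : n = x - a *: y; [rewrite xE addrK|apply: subB => //; apply: subZ].
  by split; apply: subN => //; apply: subZ.
- by exists r.
Qed.

(** * Restriction of scalars and direct decompositions *)

Section Restriction.
Variables (R : comNzRingType) (L : algType R).

Definition restr (W : lmodType L) : Type := W.

Section Module.
Variable W : lmodType L.
HB.instance Definition _ := GRing.Zmodule.on (restr W).

Definition restr_scale (a : R) (x : restr W) : restr W := (a%:A : L) *: (x : W).

Fact restr_scaleA a b x :
  restr_scale a (restr_scale b x) = restr_scale (a * b) x.
Proof. by rewrite /restr_scale scalerA -scalerAl mul1r scalerA. Qed.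
Fact restr_scale1 : left_id 1 restr_scale.
Proof. by move=> x; rewrite /restr_scale scale1r scale1r. Qed.
Fact restr_scaleDr : right_distributive restr_scale +%R.
Proof. by move=> a x y; rewrite /restr_scale scalerDr. Qed.
Fact restr_scaleDl x : {morph restr_scale^~ x : a b / a + b}.
Proof. by move=> a b; rewrite /restr_scale scalerDl scalerDl. Qed.

HB.instance Definition _ := GRing.Zmodule_isLmodule.Build R (restr W)
  restr_scaleA restr_scale1 restr_scaleDr restr_scaleDl.

Lemma restr_scaleE (a : R) (x : restr W) : a *: x = (a%:A : L) *: (x : W).
Proof. by []. Qed.

Lemma sub_restr (N : W -> Prop) : is_sub N -> is_sub (N : restr W -> Prop).
Proof.
move=> sN; split; [exact: (sub0 sN)|exact: (subD sN)|].
by move=> a x Nx; exact: (@subZ L W N sN (a%:A) x).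
Qed.

(** Submodules over [L] are submodules over [R], so chains over [L] are no longer than chains over
    [R]. *)
Lemma lenle_restr n (B : W -> Prop) : lenle n (B : restr W -> Prop) -> lenle n B.
Proof.
elim: n B => // n IH B Bn C sC CB nC; apply: IH.
by apply: Bn => //; exact: (sub_restr sC).
Qed.

Lemma fin_gen_restr : fin_gen (L : lmodType R) -> fin_gen W -> fin_gen (restr W).
Proof.
move=> /fin_gen_span[t tL] /fin_gen_span[s sW]; apply/fin_gen_span.
exists [seq a *: (x : W) : restr W | a <- t, x <- s] => w N sN Ns.
have [c ->] := spanE (sW w).
apply: (@sub_sum R (restr W) N _ _ _ sN) => i; set x := s`_i.
have xs : x \in s by apply: mem_nth.
apply: (@span_sub R L t (fun a => N (a *: x))) (tL _) => [|a at_].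
  split; first by rewrite scale0r; apply: (sub0 sN).
    by move=> a b Na Nb; rewrite scalerDl; apply: (subD sN).
  move=> r a Na; have -> : (r *: a) *: x = r *: (a *: x : restr W).
    by rewrite restr_scaleE scalerA -scalerAl mul1r.
  exact: (subZ sN).
by apply: Ns; apply: allpairs_f.
Qed.

End Module.

Lemma restr_linear (V W : lmodType L) (f : {linear V -> W}) :
  linear (f : restr V -> restr W).
Proof. by move=> a x y; rewrite !restr_scaleE linearP. Qed.

Hypothesis hL : artin_algebra L.

Lemma fg_flen (W : lmodType L) : fin_gen W -> flen (fun _ : W => True).
Proof.
move=> fW; have [n Wn] := fin_gen_flen (artinian_flen hL.1) (fin_gen_restr hL.2 fW).
by exists n; apply: lenle_restr.
Qed.

End Restriction.

(** * Direct sums, split epimorphisms and Fitting's lemma *)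

Section Decomposition.
Variable A : nzRingType.
Implicit Types X Y Z W M : lmodType A.

Lemma iso_refl X : iso X X.
Proof. by exists idfun, idfun. Qed.

Lemma iso_sym X Y : iso X Y -> iso Y X.
Proof. by case=> f [g [fK gK]]; exists g, f. Qed.

Lemma bijective_iso X Y (f : {linear X -> Y}) : bijective f -> iso X Y.
Proof. by move=> /bij_iso[g [fK gK]]; exists f, g. Qed.

Lemma fin_gen_smod M (N : M -> Prop) (sN : is_sub N) :
  flen (fun _ : M => True) -> fin_gen (smod sN).
Proof.
move=> fM; have [|s [sN' Ns]] := flen_span sN; first exact: flen_sub fM.
have /choice[l lE] (x : M) : exists l : smod sN, N x -> sval_ l = x.
  have [Nx|nNx] := pselect (N x); last by exists 0.
  by exists (smk sN Nx).
apply/fin_gen_span; exists (map l s) => y K sK Ks.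
have [x xs|z Kz /(@sval_inj _ _ _ sN) -> //] :=
  @span_sub _ _ s _ (sval_ y) (sub_im (@sval_ _ _ _ sN) sK) _ (Ns _ (svalP y)).
by exists (l x); [apply/Ks/map_f|exact/esym/lE/sN'].
Qed.

Lemma direct_sum_iso X (K N : X -> Prop) (sK : is_sub K) (sN : is_sub N) :
  (forall x, K x -> N x -> x = 0) -> (forall x, subs_add K N x) ->
  iso X (smod sK * smod sN)%type.
Proof.
move=> KN0 KNX; apply: iso_sym.
have [f fE] : exists f : {linear (smod sK * smod sN)%type -> X},
    f =1 fun x => sval_ x.1 + sval_ x.2.
  by apply: linear_fun => a x y /=; rewrite scalerDr addrACA.
apply: (bijective_iso (f := f)); apply: inj_surj_bij.
  apply: linear_inj => -[k n]; rewrite fE /= => /eqP; rewrite addr_eq0 => /eqP kn.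
  have k0 : sval_ k = 0.
    by apply: KN0; [exact: svalP|rewrite kn; apply: subN => //; exact: svalP].
  have n0 : sval_ n = 0 by apply/eqP; rewrite -oppr_eq0 -kn k0.
  by congr pair; apply: sval_inj; rewrite ?k0 ?n0.
by move=> x; have [k [n [Kk Nn ->]]] := KNX x; exists (smk sK Kk, smk sN Nn); rewrite fE.
Qed.

Lemma smod_zero X (K : X -> Prop) (sK : is_sub K) :
  zero_module (smod sK) -> forall x, K x -> x = 0.
Proof. by move=> K0 x Kx; have := congr1 (@sval_ _ _ _ sK) (K0 (smk sK Kx)). Qed.

Lemma indecomposable_direct_sum X (K N : X -> Prop) :
  indecomposable X -> is_sub K -> is_sub N ->
  (forall x, K x -> N x -> x = 0) -> (forall x, subs_add K N x) ->
  (forall x, K x -> x = 0) \/ (forall x, N x -> x = 0).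
Proof.
move=> [_ iX] sK sN KN0 KNX.
by have [/smod_zero|/smod_zero] := iX _ _ (direct_sum_iso sK sN KN0 KNX); [left|right].
Qed.

(** [W] is the direct sum of the kernel of [h] and the image of [g]; the image is nonzero because
    [X] is, so the kernel vanishes. *)
Lemma split_epi_iso W X (h : {linear W -> X}) (g : {linear X -> W}) :
  indecomposable W -> ~ zero_module X -> cancel g h -> iso W X.
Proof.
move=> iW nX gK; have [k0|g0] : (forall w, h w = 0 -> w = 0) \/
    (forall w, im g (fun=> True) w -> w = 0).
  apply: (indecomposable_direct_sum iW (sub_ker h) (sub_im g (sub_all _))).
    by move=> w hw [x _ wE]; rewrite wE -(gK x) -wE hw linear0.
  move=> w; exists (w - g (h w)), (g (h w)); rewrite linearB gK subrr subrK.
  by split=> //; exists (h w).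
- apply: (bijective_iso (f := h)); apply: inj_surj_bij; first exact: linear_inj.
  by move=> x; exists (g x).
- case: nX => x; rewrite -(gK x) (g0 (g x)) ?linear0 //; by exists x.
Qed.

Lemma bij_sub_nilpotent X (f : {linear X -> X}) k :
  (forall x, iter k f x = 0) -> bijective (fun x => x - f x).
Proof.
move=> fk; have [F FE] : exists F : {linear X -> X}, F =1 fun x => x - f x.
  by apply: linear_fun => a x y; rewrite linearP scalerBr opprD addrACA.
apply: (eq_bij (f := F)) => //; apply: inj_surj_bij.
  apply: linear_inj => x; rewrite FE => /eqP; rewrite subr_eq0 => /eqP xf.
  by rewrite -(fk x); elim: (k) => //= j <-.
move=> y; suff [x xE] : exists x, F x = y - iter k f y.
  by exists x; rewrite xE fk subr0.
(* The witness is the partial geometric sum of the [iter i f y]. *)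
elim: (k) => [|j [x xE]]; first by exists 0; rewrite linear0 subrr.
by exists (x + iter j f y); rewrite linearD xE FE addrA subrK.
Qed.

(* Fitting's lemma *)
Lemma indecomposable_local X (f : {linear X -> X}) :
  indecomposable X -> flen (fun _ : X => True) ->
  bijective f \/ bijective (fun x => x - f x).
Proof.
move=> iX [n Xn].
have /choice[F FE] (k : nat) : exists g : {linear X -> X}, g =1 iter k f.
  apply: linear_fun => a x y.
  by elim: k => //= k ->; rewrite linearP.
have [k1 ker1] : exists k, forall x, F k.+1 x = 0 -> F k x = 0.
  apply: (@lenle_asc _ X n (fun k x => F k x = 0)) => // [i|i x].
    exact: sub_ker.
  by rewrite !FE /= => ->; rewrite linear0.
have [k2 im2] : exists k, forall x, im (F k) (fun=> True) x -> im (F k.+1) (fun=> True) x.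
  apply: (@lenle_desc _ X n (fun k => im (F k) (fun=> True))).
  - by move=> i; apply: sub_im.
  - move=> i _ [x _ ->]; exists (f x) => //.
    by rewrite !FE -iterSr.
  - by apply: lenle_sub Xn => //; apply: sub_im.
have kerS i x : F (i + k1)%N x = 0 -> F k1 x = 0.
  elim: i => // i IH; rewrite addSn => e; apply: IH.
  have e' : F k1.+1 (F i x) = 0 by rewrite !FE -iterD addSn addnC -FE.
  by rewrite FE addnC iterD -!FE; apply: ker1.
have imS i x : exists y, F k2 x = F (i + k2)%N y.
  elim: i => [|i [y ->]]; first by exists x.
  have [z _ zE] := im2 (F k2 y) (ex_intro2 _ _ y Logic.I erefl).
  by exists z; rewrite addSn -addnS !FE !iterD -!FE zE.
(* Beyond both stopping points, [F k] and its square have the same kernel and the same image, so [X]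
   is the direct sum of the two. The extra 1 makes [k] positive, which lets bijectivity pass from
   [F k] to [f]. *)
pose k := (k1.+1 + k2)%N.
have kerk x : F k (F k x) = 0 -> F k x = 0.
  have kE : k = (k2.+1 + k1)%N by rewrite /k addSnnS addnC.
  rewrite !FE -iterD {2}kE addnA -FE => /kerS.
  by rewrite FE => e; rewrite kE iterD e -FE linear0.
have imk x : exists y, F k x = F k (F k y).
  have [y yE] := imS k x; exists y.
  by rewrite {1}/k FE iterD -[iter k2 f x]FE yE !FE addnC !iterD.
have [k0|i0] : (forall x, F k x = 0 -> x = 0) \/
    (forall x, im (F k) (fun=> True) x -> x = 0).
  apply: (indecomposable_direct_sum iX (sub_ker _) (sub_im _ (sub_all _))).
    by move=> x kx [y _ xE]; move: kx; rewrite xE; apply: kerk.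
  move=> x; have [y yE] := imk x; exists (x - F k y), (F k y); rewrite subrK.
  by rewrite linearB yE subrr; split=> //; exists y.
- left; apply: inj_surj_bij.
    apply: linear_inj => x fx; apply: k0; rewrite FE /k addSn iterSr fx -FE.
    exact: linear0.
  move=> x; have [y yE] := imk x.
  exists (iter (k1 + k2) f y); apply/eqP; rewrite -subr_eq0; apply/eqP/k0.
  by rewrite linearB yE [F k y]FE /k /= subrr.
- right; apply: (@bij_sub_nilpotent X f k) => x; rewrite -FE; apply: i0.
  by exists x.
Qed.

End Decomposition.

(** * The radical *)

Section Radical.
Variable A : nzRingType.
Implicit Types X Y Z W : lmodType A.

Lemma linear_sub_comp X Y (h : {linear X -> Y}) (g : {linear Y -> X}) :
  exists F : {linear X -> X}, F =1 fun x => x - g (h x).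
Proof.
by apply: linear_fun => a x y; rewrite (linearP h) (linearP g) scalerBr opprD addrACA.
Qed.

Lemma radP X Y (h : {linear X -> Y}) :
  rad h <-> forall g : {linear Y -> X}, bijective (fun x => x - g (h x)).
Proof.
split=> rh g; first by have [u [uK Ku]] := rh g; exists u.
have [F FE] := linear_sub_comp h g; have [u [uK Ku]] := bij_iso (eq_bij (rh g) (fsym FE)).
by exists u; split=> x /=; rewrite -FE.
Qed.

Lemma rad_compl X Y Z (k : {linear Y -> Z}) (h : {linear X -> Y}) :
  rad h -> rad (k \o h).
Proof. by move=> rh g; apply: (rh (g \o k)). Qed.

(** If [u] inverts [1 - k g h], then [1 + g h u k] inverts [1 - g h k]. *)
Lemma rad_compr W X Y (h : {linear X -> Y}) (k : {linear W -> X}) :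
  rad h -> rad (h \o k).
Proof.
move=> /radP rh; apply/radP => g; have [u uK Ku] := rh (k \o g).
have [F FE] := linear_sub_comp (h \o k) g.
apply: (eq_bij (f := F)) => //; apply: inj_surj_bij => [|y].
  apply: linear_inj => x; rewrite FE /= => /eqP; rewrite subr_eq0 => /eqP xE.
  suff k0 : k x = 0 by rewrite xE k0 !linear0.
  apply: (can_inj uK).
  by rewrite /= (linear0 h) (linear0 g) (linear0 k) -xE !subrr.
have xE := Ku (k y); set x := u (k y) in xE.
exists (y + g (h x)); rewrite FE /= -addrA -[RHS]addr0; congr (_ + _).
apply/eqP; rewrite subr_eq0 linearD -xE /=.
by rewrite subrK.
Qed.

(** With [u] inverse to [1 - k f], one has [1 - k (f + g) = (1 - k f) (1 - u k g)]. *)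
Lemma rad_add X Y (f g h : {linear X -> Y}) :
  rad f -> rad g -> (forall x, h x = f x + g x) -> rad h.
Proof.
move=> /radP rf /radP rg hE; apply/radP => k.
have [F FE] := linear_sub_comp f k.
have [u [uK Ku]] := bij_iso (eq_bij (rf k) (fsym FE)).
apply: (eq_bij (bij_comp (eq_bij (rf k) (fsym FE)) (rg (u \o k)))) => x /=.
by rewrite linearB Ku FE hE linearD opprD addrA.
Qed.

Lemma rad_zero X Y (h : {linear X -> Y}) : h =1 \0 -> rad h.
Proof.
move=> h0; apply/radP => g; apply: (eq_bij (f := id)); first by exists id.
by move=> x /=; rewrite h0 linear0 subr0.
Qed.

(** The identity [h g] of [X] is radical, so [1 - 1 = 0] is bijective on [X]. *)
Lemma rad_split W X (h : {linear W -> X}) (g : {linear X -> W}) :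
  rad h -> cancel g h -> zero_module X.
Proof.
move=> /(rad_compr g)/radP/(_ idfun)[u uK _] gK x.
by rewrite -(uK x) -(uK 0) /= !gK !subrr.
Qed.

(** Without a section of [h], no [h g] is bijective, so [1 - h g] is, by Fitting's lemma;
    invertibility then passes to [1 - g h]. *)
Lemma rad_or_split W X (h : {linear W -> X}) :
  indecomposable X -> flen (fun _ : X => True) ->
  rad h \/ exists g : {linear X -> W}, cancel g h.
Proof.
move=> iX fX; have [[g gK]|nsplit] := pselect (exists g : {linear X -> W}, cancel g h).
  by right; exists g.
left.
have r1 : forall g : {linear X -> W}, bijective (fun x => x - h (g x)).
  move=> g; have [|//] := indecomposable_local (h \o g) iX fX.
  move=> /bij_iso[u [uK Ku]]; case: nsplit; exists (g \o u) => x.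
  exact: Ku.
apply/radP => g; have [u uK Ku] := r1 g.
have [F FE] := linear_sub_comp h g.
apply: (eq_bij (f := F)) => //; apply: inj_surj_bij => [|y].
  apply: linear_inj => x; rewrite FE /= => /eqP; rewrite subr_eq0 => /eqP xE.
  suff h0 : h x = 0 by rewrite xE h0 linear0.
  by apply: (can_inj uK); rewrite /= -xE (linear0 g) (linear0 h) !subrr.
have xE := Ku (h y); set x := u (h y) in xE.
exists (y + g x); by rewrite FE /= linearD -xE subrK addrK.
Qed.

Variable C : lmodType A -> Prop.

Lemma rad_comp_compl i X Y (h : {linear X -> Y}) : rad_comp C i h ->
  forall Z (k : {linear Y -> Z}), rad_comp C i (k \o h).
Proof.
elim=> {i X Y h} [X Y h rh Z k|i X Y Z g f h CY rg IH rf hE W k].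
  by constructor; apply: rad_compl.
by apply: (@rad_compS _ _ _ _ _ _ (k \o g) f) => // x /=; rewrite hE.
Qed.

Lemma rad_comp_compr i X Y (h : {linear X -> Y}) : rad_comp C i h ->
  forall W (k : {linear W -> X}), rad_comp C i (h \o k).
Proof.
elim=> {i X Y h} [X Y h rh Z k|i X Y Z g f h CY rg IH rf hE W k].
  by constructor; apply: rad_compr.
apply: (@rad_compS _ _ _ _ _ _ g (f \o k)) => //; first exact: rad_compr.
by move=> x /=; rewrite hE.
Qed.

Lemma rad_comp_rcons i X Y (h : {linear X -> Y}) : rad_comp C i h ->
  forall Z (k : {linear Y -> Z}), C Y -> rad k -> rad_comp C i.+1 (k \o h).
Proof.
elim=> {i X Y h} [X Y h rh Z k CY rk|i X Y Z g f h CY rg IH rf hE W k CZ rk].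
  by apply: (@rad_compS _ _ _ _ _ _ k h) => //; constructor.
apply: (@rad_compS _ _ _ _ _ _ (k \o g) f) => //; first exact: IH.
by move=> x /=; rewrite hE.
Qed.

(** The two outermost factors are merged into one radical map. *)
Lemma rad_comp_pred i X Y (h : {linear X -> Y}) : rad_comp C i h ->
  forall k, i = k.+2 -> rad_comp C k.+1 h.
Proof.
elim=> {i X Y h} [//|i X Y Z g f h CY rg IH rf hE k [ik]].
have {hE} -> : h = g \o f by apply: linear_eq.
case: k => [|k] in ik *; first by constructor; apply: rad_compl.
by apply: (@rad_compS _ _ _ _ _ _ g f) => //; apply: IH.
Qed.

Lemma rad_pow_comp i X Y W Z (h : {linear X -> Y}) (k : {linear Y -> Z})
    (l : {linear W -> X}) :
  rad_pow C i h -> rad_pow C i (k \o h \o l).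
Proof.
case: i => // i [n [s [sP hE]]]; exists n, (fun j => k \o s j \o l).
split=> [j|x]; first exact/rad_comp_compr/rad_comp_compl.
by rewrite /= hE linear_sum.
Qed.

Lemma rad_pow_rcons i X Y Z (h : {linear X -> Y}) (k : {linear Y -> Z}) :
  C Y -> rad_pow C i h -> rad k -> rad_pow C i.+1 (k \o h).
Proof.
case: i => [|i] CY rh rk.
  exists 1%N, (fun=> k \o h); split; last by move=> x; rewrite big_ord1.
  by move=> _; constructor; apply: rad_compr.
case: rh => n [s [sP hE]]; exists n, (fun j => k \o s j).
split=> [j|x]; first exact: rad_comp_rcons.
by rewrite /= hE linear_sum.
Qed.

Lemma rad_pow_pred i X Y (h : {linear X -> Y}) :
  rad_pow C i.+1 h -> rad_pow C i h.
Proof.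
case: i => // i [n [s [sP hE]]]; exists n, s; split=> // j.
exact: rad_comp_pred (sP j) _ erefl.
Qed.

Lemma rad_pow_leq i j X Y (h : {linear X -> Y}) : (i <= j)%N ->
  rad_pow C j h -> rad_pow C i h.
Proof.
by move=> /subnK <-; elim: (j - i)%N => // k IH /rad_pow_pred.
Qed.

Lemma rad_pow_add i X Y (f g h : {linear X -> Y}) :
  rad_pow C i f -> rad_pow C i g -> (forall x, h x = f x + g x) ->
  rad_pow C i h.
Proof.
case: i => // i [n [s [sP fE]]] [m [t [tP gE]]] hE.
exists (n + m)%N, (fun k => match split k with inl k => s k | inr k => t k end).
split=> [k|x]; first by case: split.
rewrite hE fE gE big_split_ord; congr (_ + _); apply: eq_bigr => k _.
  by rewrite (unsplitK (inl k)).
by rewrite (unsplitK (inr k)).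
Qed.

End Radical.

(** * Functionals to the injective envelope of R/rad(R) *)

(** [f] descends to the image of [D], and injectivity of [I] extends it to [Y]. *)
Lemma injective_factor (A : nzRingType) (X Y I : lmodType A)
    (D : {linear X -> Y}) (f : {linear X -> I}) :
  injective_module I -> (forall x, D x = 0 -> f x = 0) ->
  exists g : {linear Y -> I}, forall x, g (D x) = f x.
Proof.
move=> injI kerD; pose sD := sub_im D (sub_all X).
have /choice[s sP] (y : smod sD) : exists x, sval_ y = D x.
  by have [x _ yE] := svalP y; exists x.
have fs y x : sval_ y = D x -> f (s y) = f x.
  rewrite sP => e; apply/eqP; rewrite -subr_eq0 -linearB; apply/eqP/kerD.
  by rewrite linearB e subrr.
have [h hE] : exists h : {linear smod sD -> I}, forall y, h y = f (s y).
  apply: linear_fun => a y z; rewrite -linearP; apply: fs.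
  by rewrite !linearP -!sP.
have [g gE] := injI _ _ (@sval_ _ _ _ sD) h (@sval_inj _ _ _ sD).
exists g => x; have Dx : im D (fun=> True) (D x) by exists x.
by have := gE (smk sD Dx); rewrite /= hE => ->; apply: fs.
Qed.

Section Cogenerator.
Local Open Scope quotient_scope.
Variables (R : comNzRingType) (J : lmodType R) (j : {linear residue R -> J}).
Hypotheses (aR : artinian R^o) (hJ : injective_envelope j).

(** Some multiple [w] of [v] generates a simple module modulo [U]. That module is [R/m] for a
    maximal ideal [m], hence embeds in the residue module and so in [J]; injectivity of [J] extends
    the functional to [V]. *)
Lemma cogenerator (V : lmodType R) (U : V -> Prop) v : is_sub U -> ~ U v ->
  exists f : {linear V -> J}, (forall u, U u -> f u = 0) /\ f v <> 0.
Proof.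
move=> sU nUv; have [injJ jI _] := hJ.
(* Minimality of [Q] makes [m], the annihilator of [w] modulo [U], a maximal ideal: see [mV]. *)
have [|Q [sQ [q [Qq nUq]] Qmin]] :=
    @artinian_min R R^o (fun Q => exists q : R, Q q /\ ~ U (q *: v)) aR.
  by exists (fun=> True) => //; exists 1; rewrite scale1r.
pose w := q *: v; pose m (r : R^o) := U ((r : R) *: w).
have sm : is_sub m.
  split; rewrite /m; first by rewrite scale0r; apply: sub0.
    by move=> a b; rewrite scalerDl; apply: subD.
  by move=> a b mb; rewrite -scalerA; apply: subZ.
have mM (a b : R) : m b -> m (a * b) by apply: (subZ sm).
have m1 : ~ m 1 by rewrite /m scale1r.
have mV (r : R) : ~ m r -> exists s, m (1 - s * r).
  rewrite /m /w scalerA => nmr.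
  have [||s qE] := Qmin _ (sub_cyc (r * q : R^o)) _ _ q Qq.
  - by exists (r * q); split=> //; apply: cyc_id.
  - by move=> _ [a ->]; apply: (subZ sQ); apply: (subZ sQ r).
  exists s; have -> : (1 - s * r) *: (q *: v) = 0; last exact: sub0.
  by rewrite scalerA mulrBl mul1r -mulrA -[s * _]/(s *: (_ : R^o)) -qE subrr scale0r.
have mprime (a b : R) : m (a * b) -> m a \/ m b.
  move=> mab; have [|/mV[s ms]] := pselect (m a); first by left.
  right; rewrite -(subrK (s * a * b) b); apply: (subD sm);
    last by rewrite -mulrA; apply: mM.
  by rewrite -{1}[b]mul1r -mulrBl mulrC; apply: mM.
(* By minimality of [K], its element [x] outside [m] lies in every other maximal ideal. Hence [m x]
   lies in the Jacobson radical, and the class [px] of [x] is nonzero and killed by [m]. *)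
have [|K [sK [x [Kx nmx]] Kmin]] :=
    @artinian_min R R^o (fun K => exists x : R, K x /\ ~ m x) aR.
  by exists (fun=> True) => //; exists 1.
have maxm : maximal_ideal [pred r : R | `[< m r >]].
  split=> [|I Icl mI r].
    split; [by apply/asboolP; apply: (sub0 sm)|by rewrite inE; apply/asboolP|].
    move=> a b c /asboolP mb /asboolP mc; apply/asboolP.
    by apply: (subD sm) => //; apply: mM.
  apply/idP/idP; last exact: mI.
  case: Icl => I0 I1 IP Ir; apply/asboolP; apply: contrapT => /mV[s ms].
  case/negP: I1; rewrite -(subrK (s * r) 1) addrC; apply: IP => //.
  by apply: mI; apply/asboolP.
have njx : x \notin @jacobson R.
  by apply/negP => /asboolP/(_ _ maxm)/asboolP.
have jmx (r : R) : m r -> r * x \in @jacobson R.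
  move=> mr; apply/asboolP => m' [cl' max']; case: (cl') => m'0 m'1 m'P.
  have m'M (a b : R) : b \in m' -> a * b \in m'.
    by move=> bm; rewrite -[a * b]addr0; apply: m'P.
  have [xm'|/negP nxm'] := boolP (x \in m'); first exact: m'M.
  have m'm : {subset m' <= [pred r : R | `[< m r >]]}.
    move=> y ym'; apply/asboolP; apply: contrapT => nmy; apply: nxm'.
    have sm' : is_sub (fun z : R^o => z \in m').
      split; [by []| |exact: m'M].
      by move=> a b am bm; rewrite -[a]mul1r; apply: m'P.
    apply: (Kmin _ (sub_cap sK sm') _ _ x Kx).2 => [|z [] //].
    exists (y * x); split; first by split; [apply: (subZ sK y)|rewrite mulrC; apply: m'M].
    by move=> /mprime[].
  rewrite mulrC; apply: m'M; rewrite -(max' _ maxm.1 m'm).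
  exact/asboolP.
pose px : residue R := \pi_(Quotient.quot (@jacobson R)) x.
have pxE (r : R) : (r *: px == 0) = (r * x \in @jacobson R).
  have -> : r *: px = \pi_(Quotient.quot (@jacobson R)) (r * x).
    exact: residue_scaleE.
  by rewrite -[in RHS](subr0 (r * x)) Quotient.idealrBE raddf0.
(* [D] maps onto [U + R w]. On its kernel [r w] lies in [U], so [r] is in [m] and kills [px]: [f]
   factors through [D]. *)
have [D DE] : exists D : {linear (smod sU * R^o)%type -> V},
    D =1 fun p => sval_ p.1 + (p.2 : R) *: w.
  apply: linear_fun => a [y b] [z c] /=.
  by rewrite scalerDl scalerDr addrACA [a *: (b *: w)]scalerA.
have [f fE] : exists f : {linear (smod sU * R^o)%type -> J},
    f =1 fun p => j ((p.2 : R) *: px).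
  by apply: linear_fun => a [y b] [z c] /=; rewrite scalerDl linearD -scalerA linearZ.
have [|g gE] := injective_factor (D := D) (f := f) injJ.
  move=> [[u Uu] r]; rewrite DE fE /= => e.
  have /jmx : m r.
    by rewrite /m -[_ *: w](addKr u) e addr0; apply: subN.
  by rewrite -pxE => /eqP ->; rewrite linear0.
exists g; split=> [u Uu|gv].
  by have := gE (smk sU Uu, 0); rewrite DE fE /= !scale0r linear0 addr0.
have := gE (0, 1); rewrite DE fE /= add0r !scale1r /w linearZ_LR gv scaler0.
move/esym; rewrite -(linear0 j) => /jI/eqP.
by rewrite -[px]scale1r pxE mul1r (negbTE njx).
Qed.

End Cogenerator.

(** * Right almost split maps *)

Section FiniteFunctions.
Variable A : nzRingType.
Implicit Types M X Y : lmodType A.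

Definition single M n (i : 'I_n) (x : M) : {ffun 'I_n -> M} :=
  [ffun k => if k == i then x else 0].

Lemma single_linear M n (i : 'I_n) : linear (@single M n i).
Proof.
move=> a x y; apply/ffunP => k; rewrite !ffunE.
by case: eqP => // _; rewrite scaler0 addr0.
Qed.
HB.instance Definition _ M n (i : 'I_n) :=
  GRing.isLinear.Build A M {ffun 'I_n -> M} *:%R (single i) (single_linear i).

Lemma sum_single M n (w : {ffun 'I_n -> M}) : w = \sum_i single i (w i).
Proof.
apply/ffunP => k; rewrite sum_ffunE (bigD1 k) //= ffunE eqxx big1 ?addr0 // => i.
by rewrite ffunE eq_sym => /negbTE ->.
Qed.

Lemma fin_gen_ffun M n : fin_gen M -> fin_gen {ffun 'I_n -> M}.
Proof.
move=> /fin_gen_span[s sM]; apply/fin_gen_span.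
exists [seq single i x | i <- enum 'I_n, x <- s] => w N sN Ns.
rewrite (sum_single w); apply: sub_sum => // i.
apply: (span_sub (sub_preim (single i) sN) _ (sM (w i))) => x xs.
by apply: Ns; apply: allpairs_f => //; rewrite mem_enum.
Qed.

Lemma fin_gen_prod X Y : fin_gen X -> fin_gen Y -> fin_gen (X * Y)%type.
Proof.
move=> /fin_gen_span[s sX] /fin_gen_span[t tY]; apply/fin_gen_span.
exists ([seq (x, 0) | x <- s] ++ [seq (0, y) | y <- t]) => -[x y] N sN Ns.
have [inl_ inlE] : exists h : {linear X -> (X * Y)%type}, h =1 fun x => (x, 0).
  by apply: linear_fun => a u v; congr pair; rewrite /= scaler0 addr0.
have [inr_ inrE] : exists h : {linear Y -> (X * Y)%type}, h =1 fun y => (0, y).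
  by apply: linear_fun => a u v; congr pair; rewrite /= scaler0 addr0.
have -> : (x, y) = inl_ x + inr_ y.
  by rewrite inlE inrE; congr pair; rewrite /= ?addr0 ?add0r.
apply: subD => //.
  apply: (span_sub (sub_preim inl_ sN) _ (sX x)) => u us.
  by rewrite inlE; apply: Ns; rewrite mem_cat map_f.
apply: (span_sub (sub_preim inr_ sN) _ (tY y)) => u us.
by rewrite inrE; apply: Ns; rewrite mem_cat map_f ?orbT.
Qed.

Lemma fin_gen_regular : fin_gen A^o.
Proof.
apply/fin_gen_span; exists [:: 1] => x N sN N1.
by rewrite -[x]mulr1; apply: (subZ sN); apply: N1; rewrite inE.
Qed.

Lemma surjective_factor X Y M (e : {linear X -> Y}) (f : {linear X -> M}) :
  surj e -> (forall x, e x = 0 -> f x = 0) ->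
  exists g : {linear Y -> M}, forall x, g (e x) = f x.
Proof.
move=> /choice[s sP] kere.
have fs x y : e x = e y -> f x = f y.
  move=> exy; apply/eqP; rewrite -subr_eq0 -linearB; apply/eqP/kere.
  by rewrite linearB exy subrr.
have [g gE] : exists g : {linear Y -> M}, g =1 fun y => f (s y).
  by apply: linear_fun => a y z; rewrite -linearP; apply: fs; rewrite linearP !sP.
by exists g => x; rewrite gE; apply: fs.
Qed.

End FiniteFunctions.

Lemma dual_scaleDE (R : comNzRingType) (L : algType R) (J : lmodType R)
    (r : L) (f g : dual L J) c : (r *: f + g) c = f (c * r) + g c.
Proof. by []. Qed.

Section AlmostSplit.
Variables (R : comNzRingType) (L : algType R) (hL : artin_algebra L).
Variables (J : lmodType R) (j : {linear residue R -> J}).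
Hypothesis hJ : injective_envelope j.
Variable C : lmodType L -> Prop.
Hypotheses (C_additive : additive_subcategory C)
  (C_ffinite : functorially_finite C) (C_dual : C (dual L J)).

Let injJ : injective_module J. Proof. by case: hJ. Qed.

Section Presentation.
Variables (X : lmodType L) (n : nat) (v : 'I_n -> X).
Hypotheses (iX : indecomposable X)
  (vX : forall x : X, exists c : 'I_n -> L, x = \sum_(i < n) c i *: v i).

Let vf : {ffun 'I_n -> restr X} := [ffun i => v i : restr X].

(* A trace-like form: a functional on X^n killing the radical of End(X), which
   sits in X^n by evaluation at the generators. *)
Lemma radical_functional : exists Phi : {linear {ffun 'I_n -> restr X} -> J},
  Phi vf <> 0 /\ forall g : {linear X -> X}, rad g ->
    Phi [ffun i => g (v i) : restr X] = 0.
Proof.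
pose U (w : {ffun 'I_n -> restr X}) :=
  exists g : {linear X -> X}, rad g /\ forall i, w i = g (v i).
have [||Phi [PhiU Phiv]] := @cogenerator R J j hL.1 hJ _ U vf; last first.
- exists Phi; split=> // g rg; apply: PhiU; exists g; split=> // i.
  by rewrite ffunE.
(* A radical [g] fixing the generators would be the identity, forcing [X = 0]. *)
- move=> [g [rg gE]]; apply: iX.1; apply: (rad_split (h := g) (g := idfun)) => // x /=.
  have [c ->] := vX x; rewrite linear_sum; apply: eq_bigr => i _.
  by rewrite linearZ_LR -gE ffunE.
- split.
  + exists \0; split; first exact: rad_zero.
    by move=> i; rewrite ffunE.
  + move=> w1 w2 [g1 [rg1 g1E]] [g2 [rg2 g2E]]; exists (g1 \+ g2); split.
      exact: rad_add rg1 rg2 _.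
    by move=> i; rewrite ffunE g1E g2E.
  + move=> a w [g [rg gE]].
    have [s sE] : exists s : {linear X -> X}, s =1 fun x => (a%:A : L) *: x.
      apply: linear_fun => b x y; rewrite scalerDr !scalerA; congr (_ *: _ + _).
      by rewrite -scalerAl mul1r -scalerAr mulr1.
    exists (s \o g); split; first exact: rad_compl.
    by move=> i; rewrite ffunE gE /= sE.
Qed.

Variable Phi : {linear {ffun 'I_n -> restr X} -> J}.
Variables (d : seq {ffun 'I_n -> L^o}).
Hypothesis d_ker : forall c : {ffun 'I_n -> L^o},
  \sum_i c i *: v i = 0 <-> span d c.

Notation a := (size d).
Let dj (k : 'I_a) (i : 'I_n) : L := d`_k i.

(** This is Hom(-, W) applied to the presentation matrix [d]: a map from [W^n] to [W^a] whose kernel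
    is Hom(X, W), by [relations_hom]. *)
Definition relations (W : lmodType L) (w : {ffun 'I_n -> restr W}) :
    {ffun 'I_a -> restr W} :=
  [ffun k => \sum_i dj k i *: (w i : W)].

Lemma relations_linear W : linear (@relations W).
Proof.
move=> r w1 w2; apply/ffunP => k; rewrite !ffunE restr_scaleE scaler_sumr -big_split.
apply: eq_bigr => i _; rewrite !ffunE scalerDr restr_scaleE !scalerA.
by rewrite -scalerAl mul1r -scalerAr mulr1.
Qed.
HB.instance Definition _ W :=
  GRing.isLinear.Build R _ _ *:%R (@relations W) (@relations_linear W).

Lemma relations_hom W (w : {ffun 'I_n -> restr W}) : relations w = 0 ->
  exists g : {linear X -> W}, forall i, g (v i) = w i.
Proof.
move=> w0.
have [e eE] : exists e : {linear {ffun 'I_n -> L^o} -> X},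
    e =1 fun c => \sum_i (c i : L) *: v i.
  apply: linear_fun => r x y; rewrite scaler_sumr -big_split; apply: eq_bigr => i _.
  by rewrite !ffunE scalerDl scalerA.
have [f fE] : exists f : {linear {ffun 'I_n -> L^o} -> W},
    f =1 fun c => \sum_i (c i : L) *: (w i : W).
  apply: linear_fun => r x y; rewrite scaler_sumr -big_split; apply: eq_bigr => i _.
  by rewrite !ffunE scalerDl scalerA.
have [||g gE] := surjective_factor (e := e) (f := f).
- move=> x; have [c ->] := vX x; exists [ffun i => c i : L^o]; rewrite eE.
  by apply: eq_bigr => i _; rewrite ffunE.
- move=> c; rewrite eE => /d_ker; apply: (span_sub (sub_ker f)) => y yd.
  have ky : (index y d < a)%N by rewrite index_mem.
  have := congr1 (fun u : {ffun 'I_a -> restr W} => u (Ordinal ky)) w0.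
  by rewrite /relations !ffunE fE /dj /= nth_index.
- exists g => i; have <- : e (single i (1 : L^o)) = v i.
    rewrite eE (bigD1 i) //= ffunE eqxx scale1r big1 ?addr0 // => k /negbTE ki.
    by rewrite ffunE ki scale0r.
  rewrite gE fE (bigD1 i) //= ffunE eqxx scale1r big1 ?addr0 // => k /negbTE ki.
  by rewrite ffunE ki scale0r.
Qed.

(* The pullback of X -> D(L)^n <- D(L)^a, where the first map is given by Phi
   and the second is Hom_R(_, J) applied to the relations. *)
Definition pullback (p : (X * {ffun 'I_a -> dual L J})%type) :=
  forall i c, Phi (single i (c *: p.1 : restr X)) =
    \sum_k (p.2 k : dual L J) (dj k i * c).

Lemma sub_pullback : is_sub pullback.
Proof.
split=> [i c|p q Pp Pq i c|b p Pp i c] /=.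
- rewrite scaler0 [single _ _]linear0 linear0 big1 // => k _.
  by rewrite ffunE.
- rewrite scalerDr [single _ _]linearD linearD Pp Pq -big_split.
  by apply: eq_bigr => k _; rewrite /= ffunE.
- rewrite scalerA Pp; apply: eq_bigr => k _.
  by rewrite /= ffunE mulrA.
Qed.

(** A section rewrites the value of [Phi] at the generators as a sum of terms
    [G (\sum_i dj k i *: v i)], one for each relation, and relations vanish in [X]. *)
Lemma pullback_no_section (f : {linear X -> {ffun 'I_a -> dual L J}}) :
  (forall x, pullback (x, f x)) -> Phi vf = 0.
Proof.
move=> Pf; rewrite (sum_single vf) linear_sum /=.
under eq_bigr => i _ do rewrite ffunE -[v i]scale1r (Pf (v i)).
rewrite exchange_big big1 // => k _ /=.
pose G x := (f x k : dual L J) 1.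
have GD : {morph G : x y / x + y} by move=> x y; rewrite /G linearD ffunE.
have G0 : G 0 = 0 by rewrite /G linear0 ffunE.
transitivity (G (\sum_i dj k i *: v i)).
  rewrite (big_morph G GD G0); apply: eq_bigr => i _.
  by rewrite /G linearZ_LR ffunE mulr1 [RHS]/(f (v i) k (1 * dj k i)) mul1r.
have -> : \sum_i dj k i *: v i = 0; last by [].
by apply: (d_ker d`_k).2; apply: span_mem; apply: mem_nth.
Qed.

Hypothesis Phi_rad : forall g : {linear X -> X}, rad g ->
  Phi [ffun i => g (v i) : restr X] = 0.

(** Composing [h] with a map from [X] to [W] gives a radical endomorphism, killed by [Phi]. So [Phi]
    after [h] vanishes on the kernel of [relations] and extends to [mu] on [W^a]; by adjunction [mu]
    is a map from [W] to the power of [dual L J]. *)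
Lemma pullback_lift (W : lmodType L) (h : {linear W -> X}) : rad h ->
  exists s : {linear W -> {ffun 'I_a -> dual L J}}, forall w, pullback (h w, s w).
Proof.
move=> rh.
have [f fE] : exists f : {linear {ffun 'I_n -> restr W} -> J},
    f =1 fun w => Phi [ffun i => h (w i) : restr X].
  apply: linear_fun => r w1 w2; rewrite -linearP; congr (Phi _).
  by apply/ffunP => i; rewrite !ffunE [LHS]linearP.
have [|mu muE] := injective_factor (D := @relations W) (f := f) injJ.
  move=> w /relations_hom[g gE]; rewrite fE.
  rewrite -[RHS](Phi_rad (g := h \o g)); last exact: rad_compr.
  by congr (Phi _); apply/ffunP => i; rewrite !ffunE /= gE.
have /choice[s sE] (w : W) : exists s : {ffun 'I_a -> dual L J},
    forall k c, (s k : dual L J) c = mu (single k (c *: w : restr W)).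
  have /choice[s sE] (k : 'I_a) : exists s : dual L J,
      forall c, s c = mu (single k (c *: w : restr W)).
    apply: (@linear_fun R L J) => r x y.
    rewrite -linearP; congr (mu _); rewrite -linearP scalerDl restr_scaleE scalerA.
    by rewrite -scalerAl mul1r.
  by exists [ffun k => s k] => k c; rewrite ffunE.
have [S SE] : exists S : {linear W -> {ffun 'I_a -> dual L J}}, S =1 s.
  apply: linear_fun => r x y; apply/ffunP => k; apply: dualP => c.
  rewrite !ffunE dual_scaleDE !sE.
  by rewrite -linearD; congr (mu _); rewrite -linearD scalerDr scalerA.
exists S => w i c /=.
transitivity (f (single i (c *: w : restr W))).
  rewrite fE; congr (Phi _); apply/ffunP => k; rewrite !ffunE.
  by case: eqP; rewrite ?linear0 // linearZ_LR.
rewrite -muE /= [relations _]sum_single linear_sum; apply: eq_bigr => k _.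
rewrite SE sE; congr (mu (single _ _)); rewrite ffunE (bigD1 i) //= ffunE eqxx.
rewrite scalerA big1 ?addr0 // => l /negbTE li.
by rewrite ffunE li scaler0.
Qed.

End Presentation.

Lemma almost_split X : C X -> indecomposable X ->
  exists (Z : lmodType L) (q : {linear Z -> X}), [/\ C Z, rad q &
    forall (W : lmodType L) (h : {linear W -> X}), C W -> rad h ->
      exists g : {linear W -> Z}, h =1 q \o g].
Proof.
move=> CX iX; have [Cfg _ _] := C_additive.
have fX := fg_flen hL (Cfg X CX); have [n [v vX]] := Cfg X CX.
have [Phi [Phiv Phir]] := radical_functional iX vX.
have [e eE] : exists e : {linear {ffun 'I_n -> L^o} -> X},
    e =1 fun c => \sum_i (c i : L) *: v i.
  apply: linear_fun => r x y; rewrite scaler_sumr -big_split; apply: eq_bigr => i _.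
  by rewrite !ffunE scalerDl scalerA.
have [|d [d0 dker]] := flen_span (sub_ker e).
  apply: (flen_sub (B := fun=> True)); [exact: sub_ker|by []|].
  by apply/(fg_flen hL)/fin_gen_ffun/fin_gen_regular.
have d_ker (c : {ffun 'I_n -> L^o}) : \sum_i (c i : L) *: v i = 0 <-> span d c.
  rewrite -eE; split; first exact: dker.
  exact: (span_sub (sub_ker e)).
pose Z := smod (sub_pullback Phi d).
have fgZ : fin_gen Z.
  apply: fin_gen_smod; apply: (fg_flen hL); apply: fin_gen_prod; first exact: Cfg.
  by apply: fin_gen_ffun; apply: Cfg.
have [_ [Y [al [CY alP]]]] := C_ffinite fgZ.
have [p pE] : exists p : {linear Z -> X}, p =1 fun z => (sval_ z).1.
  by apply: linear_fun.
exists Y, (p \o al); split=> //.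
  (* A section of [p \o al] would give a section of the pullback over [X], and hence
     [Phi vf = 0]. *)
  have [//|[g gK]] := rad_or_split (p \o al) iX fX.
  have [f fE] : exists f : {linear X -> {ffun 'I_(size d) -> dual L J}},
      f =1 fun x => (sval_ (al (g x))).2.
    by apply: linear_fun => r x y; rewrite !linearP.
  case: Phiv; apply: (pullback_no_section d_ker (f := f)) => x.
  have -> : (x, f x) = sval_ (al (g x)); last exact: svalP.
  rewrite fE -{1}(gK x) /= pE; by case: (sval_ _).
move=> W h CW rh; have [s sP] := pullback_lift vX d_ker Phir rh.
have [hs hsE] : exists hs : {linear W -> (X * {ffun 'I_(size d) -> dual L J})%type},
    hs =1 fun w => (h w, s w).
  by apply: linear_fun => r x y; rewrite !linearP.
have [|l lE] := lift_smod (sub_pullback Phi d) (f := hs).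
  by move=> w; rewrite hsE.
have [g gE] := alP W l CW; exists g => w /=; rewrite pE.
by rewrite [al _]gE lE hsE.
Qed.

End AlmostSplit.

(** * Nilpotent radical implies finite type *)

Section Induction.
Variable A : nzRingType.
Implicit Types X Y Z M : lmodType A.

Lemma iso_prod_maps X Y Z : iso X (Y * Z)%type ->
  exists (p : {linear X -> Y}) (q : {linear X -> Z})
    (i : {linear Y -> X}) (k : {linear Z -> X}),
  [/\ forall x, x = i (p x) + k (q x), cancel i p, cancel k q &
      forall z, p (k z) = 0].
Proof.
case=> f [g [fK gK]].
have [p pE] : exists p : {linear X -> Y}, p =1 fun x => (f x).1.
  by apply: linear_fun => a x y; rewrite linearP.
have [q qE] : exists q : {linear X -> Z}, q =1 fun x => (f x).2.
  by apply: linear_fun => a x y; rewrite linearP.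
have [i iE] : exists i : {linear Y -> X}, i =1 fun y => g (y, 0).
  apply: linear_fun => a x y; rewrite -linearP; congr (g _); congr pair.
  by rewrite /= scaler0 addr0.
have [k kE] : exists k : {linear Z -> X}, k =1 fun z => g (0, z).
  apply: linear_fun => a x y; rewrite -linearP; congr (g _); congr pair.
  by rewrite /= scaler0 addr0.
exists p, q, i, k; split=> x; rewrite ?pE ?qE ?iE ?kE ?gK //.
rewrite -linearD -[LHS]fK; congr (g _); case: (f x) => y z /=.
by congr pair; rewrite /= ?addr0 ?add0r.
Qed.

Lemma iso_swap X Y Z : iso X (Y * Z)%type -> iso X (Z * Y)%type.
Proof.
case=> f [g [fK gK]].
have [s sE] : exists s : {linear X -> (Z * Y)%type}, s =1 fun x => ((f x).2, (f x).1).
  by apply: linear_fun => a x y; rewrite linearP.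
apply: (bijective_iso (f := s)); exists (fun y => g (y.2, y.1)) => [x|[z y]].
  by rewrite sE /= -[RHS]fK; case: (f x).
by rewrite sE gK.
Qed.

(** Induction on the length: a nonzero decomposable module splits into two shorter summands, again
    in [C]. *)
Lemma decomposition_ind (C P : lmodType A -> Prop) :
  summand_closed C -> (forall X, C X -> flen (fun _ : X => True)) ->
  (forall X, C X -> zero_module X -> P X) ->
  (forall X, C X -> indecomposable X -> P X) ->
  (forall X Y Z, C X -> iso X (Y * Z)%type -> C Y -> C Z -> P Y -> P Z -> P X) ->
  forall X, C X -> P X.
Proof.
move=> Csum Clen P0 Pi PM X CX; have [n] := Clen X CX.
elim: n X CX => [|n IH] X CX Xn; first by apply: P0 => // x; apply: Xn.
have [zX|nzX] := pselect (zero_module X); first exact: P0.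
have [iX|niX] := pselect (indecomposable X); first exact: Pi.
have [Y [Z [XYZ nY nZ]]] : exists Y Z : lmodType A,
    [/\ iso X (Y * Z)%type, ~ zero_module Y & ~ zero_module Z].
  apply: contrapT => nYZ; apply: niX; split=> // Y Z XYZ.
  have [|nY] := pselect (zero_module Y); first by left.
  by right; apply: contrapT => nZ; apply: nYZ; exists Y, Z.
have shorter (U V : lmodType A) : iso X (U * V)%type -> ~ zero_module V ->
    lenle n (fun _ : U => True).
  move=> /iso_prod_maps[p [q [i [k [xE iK kK pk]]]]] nV.
  apply: (lenle_inj (f := i)) => //; first exact: can_inj iK.
  apply: Xn => //; first exact: sub_im.
  apply: contrapT => nk; apply: nV => z; rewrite -(kK z).
  have [y _ ky] : im i (fun=> True) (k z).
    by apply: contrapT => nz; apply: nk; exists (k z).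
  by rewrite ky -[y]iK -ky pk linear0 linear0.
have CY := Csum _ _ _ XYZ CX; have CZ := Csum _ _ _ (iso_swap XYZ) CX.
apply: (PM X Y Z) => //; apply: IH => //; first exact: shorter XYZ nZ.
exact: shorter (iso_swap XYZ) nY.
Qed.

Lemma rad_pow_zero (C : lmodType A -> Prop) i X Y (h : {linear X -> Y}) :
  h =1 \0 -> rad_pow C i h.
Proof.
case: i => // i h0; exists 0%N, (fun=> h); split=> [[]//|x].
by rewrite big_ord0 h0.
Qed.

End Induction.

Section FiniteType.
Variables (R : comNzRingType) (L : algType R) (hL : artin_algebra L).
Variables (J : lmodType R) (j : {linear residue R -> J}).
Hypothesis hJ : injective_envelope j.
Variable C : lmodType L -> Prop.
Hypotheses (C_additive : additive_subcategory C) (C_summand : summand_closed C)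
  (C_ffinite : functorially_finite C) (C_dual : C (dual L J)).
Implicit Types X Y Z M : lmodType L.

Let C_fg X : C X -> fin_gen X. Proof. by case: C_additive => + _ _; apply. Qed.
Let C_flen X : C X -> flen (fun _ : X => True).
Proof. by move=> /C_fg; apply: fg_flen. Qed.

Definition finite_family n (T : 'I_n -> lmodType L) :=
  forall i, C (T i) /\ indecomposable (T i).

(* A map from X to an indecomposable summand of M is an isomorphism or factors
   through its almost split map; iterate. *)
Lemma finitely_many_shallow k M : C M ->
  exists n (T : 'I_n -> lmodType L), finite_family T /\
    forall X, C X -> indecomposable X -> (forall i, ~ iso X (T i)) ->
      forall h : {linear X -> M}, rad_pow C k h.
Proof.
elim: k M => [|k IH] M CM.
  by exists 0%N, (fun _ => M); split=> // i; case: (i).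
move: M CM; apply: decomposition_ind => // [M CM zM|M CM iM|M Y Z CM MYZ CY CZ].
- exists 0%N, (fun _ => M); split=> [i|X _ _ _ h]; first by case: (i).
  by apply: rad_pow_zero => x; exact: zM.
- have [Z [q [CZ rq qP]]] := almost_split hL hJ C_additive C_ffinite C_dual CM iM.
  have [n [T [fT TP]]] := IH Z CZ.
  (* Index 0 holds [M] itself: a split map from [X] onto [M] is an isomorphism, so outside the
     family every [h] is radical. *)
  exists n.+1, (fun i => if unlift ord0 i is Some i' then T i' else M).
  split=> [i|X CX iX nX h]; first by case: unliftP => // i' _; apply: fT.
  have rh : rad h.
    have [//|[g gK]] := rad_or_split h iM (C_flen CM).
    case: (nX ord0); rewrite unlift_none; apply: split_epi_iso gK => //.
    by case: iM.
  have [g gE] := qP X h CX rh; rewrite (linear_eq gE).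
  apply: rad_pow_rcons => //; apply: TP => // i.
  by have := nX (lift ord0 i); rewrite liftK.
- move=> [n [T [fT TP]]] [m [U [fU UP]]].
  exists (n + m)%N, (fun i => match split i with inl i => T i | inr i => U i end).
  split=> [i|X CX iX nX h]; first by case: split.
  have [p [q [i [l [xE _ _ _]]]]] := iso_prod_maps MYZ.
  apply: (@rad_pow_add _ _ _ _ _ (i \o (p \o h) \o idfun) (l \o (q \o h) \o idfun)).
  + apply: rad_pow_comp; apply: TP => // t.
    by have := nX (unsplit (inl t)); rewrite unsplitK.
  + apply: rad_pow_comp; apply: UP => // t.
    by have := nX (unsplit (inr t)); rewrite unsplitK.
  + by move=> x /=; rewrite -xE.
Qed.

(** A functional [f] on [X] over [R] corresponds to the map over [L] sending [y] to
    [c |-> f (c *: y)]; evaluation at 1 recovers [f]. *)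
Lemma dual_cogenerates X : ~ zero_module X ->
  exists h : {linear X -> dual L J}, ~ (h =1 \0).
Proof.
move=> nX; have [x nx] : exists x : X, x <> 0.
  by apply: contrapT => nx; apply: nX => x; apply: contrapT => x0; apply: nx; exists x.
have [f [_ fx]] := cogenerator hL.1 hJ (sub_zero (restr X)) nx.
have /choice[s sE] (y : X) : exists s : dual L J, forall c, s c = f (c *: y).
  apply: (@linear_fun R L J) => r a b.
  rewrite -linearP; congr (f _); rewrite scalerDl restr_scaleE scalerA.
  by rewrite -scalerAl mul1r.
have [h hE] : exists h : {linear X -> dual L J}, h =1 s.
  apply: linear_fun => r y z; apply: dualP => c; rewrite dual_scaleDE !sE.
  by rewrite -linearD scalerDr scalerA.
exists h => h0; apply: fx; have := sE x 1; rewrite scale1r => <-.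
by rewrite -hE h0.
Qed.

Lemma nilpotent_finite_rep_type d :
  (forall X Y (h : {linear X -> Y}), C X -> C Y -> rad_pow C d h -> h =1 \0) ->
  finite_rep_type C.
Proof.
move=> nil; have [n [T [fT TP]]] := finitely_many_shallow d C_dual.
exists n, T; split=> // X CX iX; apply: contrapT => nT.
have [h []] := dual_cogenerates iX.1; apply: nil => //; apply: TP => // i XT.
by apply: nT; exists i.
Qed.

End FiniteType.

(** * Finite type implies nilpotent radical *)

Section Nilpotency.
Variables (R : comNzRingType) (L : algType R) (hL : artin_algebra L).
Implicit Types X Y Z : lmodType L.

Lemma restr_mul X (a : R) :
  exists s : {linear X -> X}, forall x, s x = a *: (x : restr X).
Proof.
apply: linear_fun => b x y; rewrite scalerDr !restr_scaleE !scalerA.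
by congr (_ *: _ + _); rewrite -scalerAl mul1r -scalerAr mulr1.
Qed.

Section PowersOfRadical.
Variable M : lmodType L.

(* J^k M for J = rad End(M), as an R-module. *)
Fixpoint radM k (y : restr M) : Prop :=
  if k is k'.+1 then
    forall N : restr M -> Prop, is_sub N ->
      (forall (e : {linear M -> M}) z, rad e -> radM k' z -> N (e z)) -> N y
  else True.

Lemma sub_radM k : is_sub (radM k).
Proof.
case: k => [//|k]; split=> [N sN _|x y Nx Ny N sN NJ|a x Nx N sN NJ].
- exact: (sub0 sN).
- by apply: (subD sN); [apply: Nx|apply: Ny].
- by apply: (subZ sN); apply: Nx.
Qed.

Lemma radM_gen k (e : {linear M -> M}) z : rad e -> radM k z -> radM k.+1 (e z).
Proof. by move=> re kz N sN; apply. Qed.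

Lemma radM_comp k (g : {linear M -> M}) y : radM k y -> radM k (g y).
Proof.
case: k => // k ky N sN NJ.
apply: (ky (fun y => N (g y))) => [|e z re kz].
  have [G GE] : exists G : {linear restr M -> restr M}, G =1 g.
    exact: (linear_fun (restr_linear g)).
  split; first by rewrite -GE linear0; apply: (sub0 sN).
    by move=> u v; rewrite -!GE linearD; apply: (subD sN).
  by move=> a u; rewrite -!GE linearZ_LR; apply: (subZ sN).
exact: (NJ (g \o e) z (rad_compl g re) kz).
Qed.

Lemma radM_pred k y : radM k.+1 y -> radM k y.
Proof. by apply; [exact: sub_radM|move=> e z _; apply: radM_comp]. Qed.

(** The End(M)-submodule generated by [s]; Nakayama's lemma is applied over End(M). *)
Definition end_span (s : seq M) (y : restr M) :=
  forall N : restr M -> Prop, is_sub N ->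
    (forall (g : {linear M -> M}) x, x \in s -> N (g x)) -> N y.

Lemma sub_end_span s : is_sub (end_span s).
Proof.
split=> [N sN _|x y Nx Ny N sN Ns|a x Nx N sN Ns].
- exact: (sub0 sN).
- by apply: (subD sN); [apply: Nx|apply: Ny].
- by apply: (subZ sN); apply: Nx.
Qed.

Lemma end_span_comp s (g : {linear M -> M}) y : end_span s y -> end_span s (g y).
Proof.
have [G GE] : exists G : {linear restr M -> restr M}, G =1 g.
  exact: (linear_fun (restr_linear g)).
move=> sy N sN Ns; rewrite -GE; apply: (sy _ (sub_preim G sN)) => f x xs.
by rewrite GE; apply: (Ns (g \o f)).
Qed.

Lemma end_span_cons s x y : end_span (x :: s) y ->
  exists (g : {linear M -> M}) u, end_span s u /\ y = g x + u.
Proof.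
move=> sy; apply: (sy (fun y => exists (g : {linear M -> M}) u,
  end_span s u /\ y = g x + u)); first split.
- by exists \0, 0; split; [exact: (sub0 (sub_end_span s))|rewrite /= addr0].
- move=> _ _ [g [u [su ->]]] [h [v [sv ->]]]; exists (g \+ h), (u + v).
  by split; [apply: (subD (sub_end_span s))|rewrite /= addrACA].
- move=> a _ [g [u [su ->]]]; have [r rE] := restr_mul M a.
  exists (r \o g), (a *: u); split; first exact: (subZ (sub_end_span s)).
  by rewrite scalerDr /= rE.
move=> g z; rewrite inE => /predU1P[->|zs].
  by exists g, 0; split; [exact: (sub0 (sub_end_span s))|rewrite addr0].
by exists \0, (g z); split; [move=> N sN; apply|rewrite /= add0r].
Qed.

(** Generators are dropped one at a time: [x = e x + u] with [e] radical and [u] in the span of the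
    others, and [1 - e] is invertible. *)
Lemma radM_nakayama k : (forall y, radM k y -> radM k.+1 y) ->
  forall s, (forall x, x \in s -> radM k x) ->
    (forall y, radM k y -> end_span s y) -> forall y, radM k y -> y = 0.
Proof.
move=> kJ; elim=> [|x s IH] ks span_s.
  by move=> y /span_s sy; apply: (sy (fun y => y = 0)) => //; apply: sub_zero.
apply: IH => [z zs|]; first by apply: ks; rewrite inE zs orbT.
have ssx y : radM k.+1 y ->
    exists (e : {linear M -> M}) u, [/\ rad e, end_span s u & y = e x + u].
  move=> ky; apply: (ky (fun y => exists (e : {linear M -> M}) u,
    [/\ rad e, end_span s u & y = e x + u])); first split.
  - exists \0, 0; split; [exact: rad_zero|exact: (sub0 (sub_end_span s))|].
    by rewrite /= addr0.
  - move=> _ _ [g [u [rg su ->]]] [h [v [rh sv ->]]]; exists (g \+ h), (u + v).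
    split; [exact: rad_add rg rh _|exact: (subD (sub_end_span s))|].
    by rewrite /= addrACA.
  - move=> a _ [g [u [rg su ->]]]; have [r rE] := restr_mul M a.
    exists (r \o g), (a *: u).
    split; [exact: rad_compl|exact: (subZ (sub_end_span s))|].
    by rewrite scalerDr /= rE.
  move=> e z re /span_s/end_span_cons[g [u [su ->]]].
  exists (e \o g), (e u); split; [exact: rad_compr|exact: end_span_comp|].
  exact: (linearD e).
have kx : radM k x by apply: ks; rewrite inE eqxx.
have [e [u [/radP/(_ idfun) re su xE]]] := ssx x (kJ x kx).
have sx : end_span s x.
  have [F FE] := linear_sub_comp e idfun.
  have [w [wK _]] := bij_iso (eq_bij re (fsym FE)).
  by rewrite -(wK x) FE {1}xE /= addrAC subrr add0r; apply: end_span_comp.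
move=> y /span_s sy N sN Ns; apply: sy => // g z; rewrite inE => /predU1P[->|].
  exact: (end_span_comp g sx).
exact: Ns.
Qed.

Lemma radM_nilpotent : fin_gen M -> exists k, forall y, radM k y -> y = 0.
Proof.
move=> fM; have [n Mn] := fin_gen_flen (artinian_flen hL.1) (fin_gen_restr hL.2 fM).
have [k kJ] := lenle_desc sub_radM (@radM_pred) Mn.
have [|s [sk ks]] := flen_span (sub_radM k).
  by exists n; apply: lenle_sub Mn => //; apply: sub_radM.
exists k; apply: (radM_nakayama kJ sk) => y /ks sy N sN Ns.
by apply: (span_sub sN) sy => x /(Ns idfun).
Qed.

(** The sum of the images of [J^k M] under all maps from [M] to [Z]. *)
Definition radM_in k Z (z : restr Z) :=
  forall N : restr Z -> Prop, is_sub N ->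
    (forall (c : {linear M -> Z}) y, radM k y -> N (c y)) -> N z.

Lemma sub_radM_in k Z : is_sub (@radM_in k Z).
Proof.
split=> [N sN _|x y Nx Ny N sN Ns|a x Nx N sN Ns].
- exact: (sub0 sN).
- by apply: (subD sN); [apply: Nx|apply: Ny].
- by apply: (subZ sN); apply: Nx.
Qed.

(** Equivalently, [Y] is a direct summand of a finite power of [M]. *)
Definition factors_through Y :=
  exists s : seq ({linear M -> Y} * {linear Y -> M}),
    forall y, y = \sum_(p <- s) p.1 (p.2 y).

Variable C : lmodType L -> Prop.
Hypothesis C_factor : forall Y, C Y -> factors_through Y.

(** Each intermediate identity is replaced by a sum of maps through [M]. Starting from [M], every
    factor but the last then yields a radical endomorphism of [M]; starting elsewhere, the first
    factor is also spent on reaching [M], which explains [i.-2]. *)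
Lemma rad_comp_radM i X Z (h : {linear X -> Z}) : rad_comp C i h ->
  [/\ (0 < i)%N,
      forall k (a : {linear M -> X}) y, radM k y -> radM_in (k + i.-1) (h (a y))
    & (1 < i)%N -> forall x, radM_in i.-2 (h x)].
Proof.
elim=> {i X Z h} [X Z h rh|i X Y Z g f h CY _ [i0 gM _] rf hE].
  split=> // k a y ky N sN; rewrite addn0 => NM.
  exact: (NM (h \o a) y).
have [s sE] := C_factor CY; split=> // [k a y ky|_ x].
  rewrite hE /= [f (a y)]sE linear_sum.
  apply: (sub_sum _ (sub_radM_in _ _)) => p /=.
  have -> : (k + i = k.+1 + i.-1)%N by rewrite addSnnS prednK.
  apply: gM; apply: (radM_gen (e := p.2 \o f \o a)) => //.
  exact/rad_compr/rad_compl.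
rewrite hE /= [f x]sE linear_sum.
by apply: (sub_sum _ (sub_radM_in _ _)) => p /=; apply: (gM 0%N).
Qed.

Lemma rad_pow_nilpotent : fin_gen M ->
  exists N, forall X Z (h : {linear X -> Z}), rad_pow C N h -> h =1 \0.
Proof.
(* Two factors beyond [k], one to enter [M] and one to leave it. *)
move=> /radM_nilpotent[k k0]; exists k.+2 => X Z h [n [s [sP hE]]] x.
rewrite hE big1 // => i _; have [_ _ /(_ isT)] := rad_comp_radM (sP i).
move=> /(_ x) hx; apply: (hx (fun z => z = 0)); first exact: sub_zero.
by move=> c y /k0 ->; apply: (linear0 c).
Qed.

End PowersOfRadical.

Variable C : lmodType L -> Prop.
Hypotheses (C_additive : additive_subcategory C) (C_summand : summand_closed C)
  (C_regular : C L^o).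

(** [M] is the direct sum of the [T i] and of [L^o], which serves as the object of [C] for the empty
    family. *)
Lemma common_retract n (T : 'I_n -> lmodType L) : (forall i, C (T i)) ->
  exists2 M, C M & forall i, exists (a : {linear T i -> M}) (b : {linear M -> T i}),
    cancel a b.
Proof.
have [_ _ Cprod] := C_additive.
elim: n T => [|n IH] T CT; first by exists L^o => // i; case: (i).
have [M CM MP] := IH (fun i => T (lift ord0 i)) (fun i => CT _).
exists (T ord0 * M)%type; first exact: Cprod.
have [p [q [i [k [xE iK kK _]]]]] := 
  iso_prod_maps (iso_refl (T ord0 * M)%type).
move=> t; case: (unliftP ord0 t) => [t' ->|->]; last by exists i, p.
have [a [b aK]] := MP t'; exists (k \o a), (b \o q).
exact: can_comp.
Qed.

Lemma finite_rep_type_nilpotent : finite_rep_type C ->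
  exists N, forall X Z (h : {linear X -> Z}), rad_pow C N h -> h =1 \0.
Proof.
move=> [n [T [CT TP]]]; have [Cfg _ _] := C_additive.
have [M CM MP] := common_retract (fun i => (CT i).1).
apply: (@rad_pow_nilpotent M); last exact: Cfg.
apply: decomposition_ind => // [X /Cfg|X CX X0|X CX iX|X Y Z CX XYZ CY CZ [s sE] [t tE]].
- exact: fg_flen.
- by exists [::] => x; rewrite big_nil.
- have [i [f [g [fK _]]]] := TP X CX iX; have [a [b aK]] := MP i.
  exists [:: (g \o b : {linear _ -> _}, a \o f : {linear _ -> _})] => x.
  by rewrite big_seq1 /= aK fK.
- have [p [q [i [k [xE _ _ _]]]]] := iso_prod_maps XYZ.
  pose via U (k' : {linear U -> X}) (p' : {linear X -> U})
      (u : {linear M -> U} * {linear U -> M}) :=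
    (k' \o u.1 : {linear M -> X}, u.2 \o p' : {linear X -> M}).
  exists (map (via Y i p) s ++ map (via Z k q) t) => x.
  rewrite big_cat !big_map /= -!linear_sum -sE -tE.
  exact: xE.
Qed.

End Nilpotency.

(** * The morphisms theta_S *)

Section SimpleModules.
Variable A : nzRingType.
Implicit Types M S X Y : lmodType A.

Lemma simpleP S : simple S <-> ~ zero_module S /\
  forall N : S -> Prop, is_sub N -> (forall x, N x -> x = 0) \/ (forall x, N x).
Proof.
split=> -[nS sS]; split=> // N sN.
  have [|N0|NS] := sS [pred x | `[< N x >]].
  - split=> [|a x y]; first by apply/asboolP; apply: sub0.
    move=> /asboolP Nx /asboolP Ny; apply/asboolP.
    by apply: (subD sN) => //; apply: (subZ sN).
  - by left=> x Nx; apply: N0; apply/asboolP.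
  - by right=> x; apply/asboolP; apply: NS.
apply: (sS (fun x => x \in N)); case: sN => N0 NP; split=> // [x y Nx Ny|a x Nx].
  by rewrite -[x]scale1r; apply: NP.
by rewrite -[_ *: _]addr0; apply: NP.
Qed.

Lemma simple_surj X S (f : {linear X -> S}) x : simple S -> f x <> 0 -> surj f.
Proof.
move=> /simpleP[_ sS] fx y; have [f0|fS] := sS _ (sub_im f (sub_all X)).
  by case: fx; apply: f0; exists x.
by have [z _ ->] := fS y; exists z.
Qed.

Lemma simple_inj S Y (f : {linear S -> Y}) x : simple S -> f x <> 0 -> injective f.
Proof.
move=> /simpleP[_ sS] fx; apply: linear_inj; have [//|f0] := sS _ (sub_ker f).
by case: fx.
Qed.

Lemma exists_simple_sub M (B : M -> Prop) : is_sub B -> flen B ->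
  (exists2 x, B x & x <> 0) ->
  exists (N : M -> Prop) (sN : is_sub N), (forall x, N x -> B x) /\ simple (smod sN).
Proof.
move=> sB fB nB; have [S [sS SB [x Sx nx] Smin]] := simple_sub sB fB nB.
exists S, sS; split=> //; apply/simpleP; split=> [z|N sN].
  by apply: nx; apply: (smod_zero z).
have [[y Ny ny]|N0] := pselect (exists2 y, N y & y <> 0).
  right=> z; have := Smin _ (sub_im (@sval_ _ _ _ sS) sN) _ _ _ (svalP z).
  case=> [_ [u _ ->]||u Nu /sval_inj -> //]; first exact: svalP.
  exists (sval_ y); first by exists y.
  by move=> y0; apply: ny; apply: sval_inj; rewrite y0.
by left=> y Ny; apply: contrapT => ny; apply: N0; exists y.
Qed.

End SimpleModules.

Section Depth.
Variables (R : comNzRingType) (L : algType R) (hL : artin_algebra L).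
Variable C : lmodType L -> Prop.
Variables (P I : lmodType L -> lmodType L).
Variables (pi : forall S : lmodType L, {linear P S -> S})
  (iota : forall S : lmodType L, {linear S -> I S}).
Hypotheses (h_pi : forall S, simple S -> projective_cover (pi S))
  (h_iota : forall S, simple S -> injective_envelope (iota S)).

Let theta (S : lmodType L) : {linear P S -> I S} := iota S \o pi S.

Lemma theta_neq0 S : simple S -> ~ (theta S =1 \0).
Proof.
move=> simS th0; have [_ pS _] := h_pi simS; have [_ iS _] := h_iota simS.
apply: simS.1 => x; have [y <-] := pS x.
by apply: iS; rewrite linear0; apply: th0.
Qed.

(** Projectivity lifts [pi S] along [p] to [u], injectivity extends [iota S] along [k] to [v], and
    [theta S = v h a u]. *)
Lemma theta_rad_pow_factor d (X Y S X' : lmodType L) (h : {linear X -> Y})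
    (a : {linear X' -> X}) (p : {linear X' -> S})
    (k : {linear S -> Y}) :
  simple S -> surj p -> injective k -> (forall x, h (a x) = k (p x)) ->
  rad_pow C d h -> rad_pow C d (theta S).
Proof.
move=> simS pS kI hE rh; have [projP _ _] := h_pi simS.
have [injI _ _] := h_iota simS.
have [u uE] := projP _ _ p (pi S) pS.
have [v vE] := injI _ _ k (iota S) kI.
suff -> : theta S = v \o h \o (a \o u) by apply: rad_pow_comp.
apply: linear_eq => x /=; rewrite hE.
by rewrite [v (k _)]vE [p (u x)]uE.
Qed.

(** Covers and envelopes are chosen module by module, so isomorphic simple modules have distinct
    [theta] to be compared. *)
Lemma theta_rad_pow_iso d (S T : lmodType L) (g : {linear S -> T}) :
  simple S -> simple T -> bijective g ->
  rad_pow C d (theta T) -> rad_pow C d (theta S).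
Proof.
move=> simS simT gbij; have [f [fK Kf]] := bij_iso gbij.
have [projP pS _] := h_pi simS; have [injI iI _] := h_iota simT.
have [u uE] := projP _ _ (pi T) (g \o pi S) (let: And3 _ p _ := h_pi simT in p).
apply: (@theta_rad_pow_factor d _ _ S (P S) _ u (pi S) (iota T \o g)) => //.
  exact: inj_comp iI (can_inj fK).
by move=> x /=; rewrite [pi T _]uE.
Qed.

Lemma rad_pow_theta d (X Y : lmodType L) (h : {linear X -> Y}) :
  flen (fun _ : Y => True) ->
  rad_pow C d h -> ~ (h =1 \0) -> exists2 S, simple S & rad_pow C d (theta S).
Proof.
move=> fY rh nh.
have sh := sub_im h (sub_all X).
have [||N [sN [Nh simN]]] := exists_simple_sub sh.
- exact: flen_sub fY.
- apply: contrapT => h0; apply: nh => x; apply: contrapT => hx.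
  by apply: h0; exists (h x) => //; exists x.
(* The preimage of the simple submodule [N] maps onto [N], as [N] lies in the image of [h]. *)
have sX' := sub_preim h sN.
have [p pE] : exists p : {linear smod sX' -> smod sN},
    forall x, sval_ (p x) = h (sval_ x).
  by apply: (lift_smod sN (f := h \o @sval_ _ _ _ sX')) => x; apply: (svalP x).
exists (smod sN) => //.
apply: (@theta_rad_pow_factor d _ _ _ _ h (@sval_ _ _ _ sX') p (@sval_ _ _ _ sN)) => //.
- move=> y; have [x _ yx] := Nh _ (svalP y).
  have Nx : N (h x) by rewrite -yx; apply: svalP.
  exists (smk sX' Nx); apply: sval_inj; rewrite pE.
  exact: esym yx.
- exact: sval_inj.
- by move=> x; exact: esym (pE x).
Qed.

(** Finiteness of the simple quotients of [M], by induction on length. Given a nonzero [f0] to a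
    simple [S0], a nonzero [f] to a simple [S] either is nonzero on the kernel of [f0], which is
    shorter, or factors through [f0], and then [S] is isomorphic to [S0]. *)
Lemma theta_depth_bound (M : lmodType L) n : lenle n (fun _ : M => True) ->
  (forall S, simple S -> finite_depth C (theta S)) ->
  exists d, forall (S : lmodType L) (f : {linear M -> S}), simple S -> ~ (f =1 \0) ->
    ~ rad_pow C d (theta S).
Proof.
move=> Mn fin; elim: n M Mn => [|n IH] M Mn.
  by exists 0%N => S f _ []; move=> x; rewrite (Mn x Logic.I) linear0.
have [[S0 [f0 [sim0 n0]]]|nf] := pselect (exists (S : lmodType L)
    (f : {linear M -> S}), simple S /\ ~ (f =1 \0)); last first.
  by exists 0%N => S f simS nf0; case: nf; exists S, f.
have [x0 fx0] : exists x0, f0 x0 <> 0.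
  by apply: contrapT => nx; apply: n0 => x; apply: contrapT => fx; apply: nx; exists x.
have sK := sub_ker f0.
have [|d dP] := IH (smod sK).
  apply: (lenle_inj (f := @sval_ _ _ _ sK)) => //; first exact: sval_inj.
  apply: Mn => //; first exact: sub_im.
  by exists x0 => // -[y _ yE]; apply: fx0; rewrite yE; exact: (svalP y).
have [d0 nd0] : exists d0, ~ rad_pow C d0 (theta S0).
  apply: contrapT => nd; apply: (fin _ sim0) => i _; apply: contrapT => ni.
  by apply: nd; exists i.
exists (maxn d d0) => S f simS nf rS.
have [fK|nfK] := pselect (f \o @sval_ _ _ _ sK =1 \0); last first.
  exact: dP nfK (rad_pow_leq (leq_maxl _ _) rS).
have [||g gE] := surjective_factor (e := f0) (f := f).
- exact: simple_surj fx0.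
- by move=> x f0x; apply: (fK (smk sK f0x)).
have [y gy] : exists y, g y <> 0.
  apply: contrapT => ny; apply: nf => x; rewrite -gE; apply: contrapT => gx.
  by apply: ny; exists (f0 x).
apply: nd0; apply: rad_pow_leq (leq_maxr d d0) _.
apply: theta_rad_pow_iso rS => //.
exact: inj_surj_bij (simple_inj sim0 gy) (simple_surj simS gy).
Qed.

(** Every simple module is a quotient of the regular module, which has finite length. *)
Lemma theta_uniform_bound : (forall S, simple S -> finite_depth C (theta S)) ->
  exists d, forall S, simple S -> ~ rad_pow C d (theta S).
Proof.
move=> fin; have [n Ln] := fg_flen hL (fin_gen_regular L).
have [d dP] := theta_depth_bound Ln fin; exists d => S simS.
have [x nx] : exists x : S, x <> 0.
  apply: contrapT => nx; apply: simS.1 => x; apply: contrapT => x0.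
  by apply: nx; exists x.
have [g gE] : exists g : {linear L^o -> S}, g =1 fun a => (a : L) *: x.
  by apply: linear_fun => a b c; rewrite scalerDl scalerA.
apply: (dP S g) => // g0; apply: nx.
by rewrite -[x]scale1r -gE g0.
Qed.

End Depth.

(** The least exponent at which [h] leaves the radical powers is positive; its predecessor is the
    depth. *)
Lemma has_depth_exists (A : nzRingType) (C : lmodType A -> Prop) (X Y : lmodType A)
    (h : {linear X -> Y}) : finite_depth C h -> exists t, has_depth C h t.
Proof.
move=> fh; have exd : exists d, `[< ~ rad_pow C d h >].
  apply: contrapT => nd; apply: fh => i _; apply: contrapT => ni.
  by apply: nd; exists i; apply/asboolP.
case: (ex_minnP exd) => -[|t] /asboolP nt tmin; first by case: nt.
exists t; split=> //; apply: contrapT => nr.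
have : (t.+1 <= t)%N by apply: tmin; apply/asboolP.
by rewrite ltnn.
Qed.

Theorem theoremF (R : comNzRingType) (L : algType R) (hL : artin_algebra L)
  (J : lmodType R) (j : {linear residue R -> J}) (hJ : injective_envelope j)
  (C : lmodType L -> Prop)
  (C_additive : additive_subcategory C)
  (C_iso : iso_closed C)
  (C_summand : summand_closed C)
  (C_ffinite : functorially_finite C)
  (C_regular : C L^o)
  (C_dual : C (dual L J))
  (P I : lmodType L -> lmodType L)
  (pi : forall S : lmodType L, {linear P S -> S})
  (iota : forall S : lmodType L, {linear S -> I S})
  (h_pi : forall S, simple S -> projective_cover (pi S))
  (h_iota : forall S, simple S -> injective_envelope (iota S)) :
  let theta (S : lmodType L) : {linear P S -> I S} := iota S \o pi S in
  let is_max_depth (m : nat) :=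
    (exists S, simple S /\ has_depth C (theta S) m) /\
    (forall S t, simple S -> has_depth C (theta S) t -> (t <= m)%N) in
  (finite_rep_type C <->
     (forall S, simple S -> finite_depth C (theta S))) /\
  (finite_rep_type C ->
     (exists m, is_max_depth m) /\
     (forall m, is_max_depth m -> nilpotency_index C m.+1)).
Proof.
move=> theta is_max_depth; have [Cfg _ _] := C_additive.
have nil d : (forall S, simple S -> ~ rad_pow C d (theta S)) ->
    forall (X Y : lmodType L) (h : {linear X -> Y}), C X -> C Y ->
      rad_pow C d h -> h =1 \0.
  move=> dP X Y h CX CY rh; apply: contrapT => nh.
  have [S simS] := rad_pow_theta h_pi h_iota (fg_flen hL (Cfg Y CY)) rh nh.
  exact: dP.
have bound : finite_rep_type C ->
    exists N, forall S, simple S -> ~ rad_pow C N (theta S).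
  move=> /(finite_rep_type_nilpotent hL C_additive C_summand C_regular)[N NP].
  by exists N => S simS /NP; apply: theta_neq0.
have finite_depth_theta : finite_rep_type C ->
    forall S, simple S -> finite_depth C (theta S).
  move=> /bound[N NP] S simS infS; apply: (NP S simS).
  (* [rad_infty] covers only exponents at least 1 and [N] may be 0, hence the detour through
     [N.+1]. *)
  by apply: rad_pow_pred; apply: infS.
split; [split=> // fin|move=> finC; split].
- have [d dP] := theta_uniform_bound hL h_pi h_iota fin.
  exact: (nilpotent_finite_rep_type hL hJ C_additive C_summand C_ffinite C_dual
    (nil d dP)).
- have [N NP] := bound finC.
  (* A simple submodule of the nonzero regular module shows that the set of depths is nonempty; [N]
     bounds it. *)
  have [|N0 [sN0 [_ simS]]] := exists_simple_sub (sub_all L^o)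
      (fg_flen hL (fin_gen_regular L)).
    by exists 1 => //; apply/eqP; apply: oner_neq0.
  have [t0 t0P] := has_depth_exists (finite_depth_theta finC _ simS).
  pose D t := `[< exists S, simple S /\ has_depth C (theta S) t >].
  have exD : exists t, D t by exists t0; apply/asboolP; exists (smod sN0).
  have [|m /asboolP Dm mmax] := @ex_maxnP D N exD.
    move=> t /asboolP[S [simS' [rt _]]]; rewrite leqNgt; apply/negP => Nt.
    by apply: (NP S simS'); apply: rad_pow_leq (ltnW Nt) rt.
  exists m; split=> // S t simS' tS; apply: mmax; apply/asboolP.
  by exists S.
(* If some [theta S] were in the power [m.+1], its depth [t <= m] would contradict
   [~ rad_pow C t.+1 (theta S)]. *)
- move=> m [_ mmax]; split=> //; apply: nil => S simS rS.
  have [t tS] := has_depth_exists (finite_depth_theta finC _ simS).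
  by apply: tS.2; apply: rad_pow_leq rS; rewrite ltnS; apply: mmax tS.
Qed.
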